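(* Let $F$ be defined on $\mathbb{R}^+$ (with $F(0)=-\infty$ allowed), continuous, increasing, concave, going to $+\infty$ at $+\infty$, with $F(1)=0$ (so that $F$ has an inverse function $F^{-1}$ defined on $]F(0),+\infty[$) and such that $F(xy)\le F(x)+F(y)$ for all positive $x,y$. Assume that $\mu$ satisfies the $F$-Sobolev inequality $$\int f^2 \, F(f^2) \, d\mu \leq -\langle Lf,f\rangle_\mu \qquad\text{for all } f \in D(L) \text{ such that } \int f^2 d\mu =1,$$ and in addition that $\mu$ satisfies the Poincaré inequality $\mathrm{Var}_\mu(f)\le -C_P\langle Lf,f\rangle_\mu$ for all $f\in D(L)$, for some constant $C_P>0$. Let $V$ be such that $\int V d\mu = 0$ and $\int V^2 d\mu = m^2 <+\infty$. Assume that $\int F^{-1}(\lambda_0 V^+) \, d\mu < + \infty$ for some $\lambda_0 > 0$ and define $$\lambda_1 = \sup \left\{0<\lambda \leq \lambda_0 \; ; \; F\left(\int F^{-1}\big(2 \lambda V \, \mathbf{1}_{\lambda V > 1/(4C_P)}\big) \, d\mu\right) \leq \frac{1}{4 C_P} \right\}.$$ Then for every probability measure $\nu$ absolutely continuous with respect to $\mu$, all $t>0$ and all $R>0$, $$\mathbb{P}_\nu\left(\frac{1}{t} \int_0^{t} V(X_s) ds \geq R\right)\leq \left\| \frac{d\nu}{d\mu}\right\|_{\mathbb{L}^2(\mu)} \exp \left\{ - t \sup_{0\leq \lambda \leq \lambda_1} \left(R \lambda - 8 m^2 C_P \lambda^2\right)\right\}.$$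
   Context: $E$ is a Polish space and $(X_t,(\mathbb{P}_x)_{x\in E})$ is a conservative continuous-time Markov process on $E$ with semigroup $(P_t)_{t\ge 0}$ and infinitesimal generator $L$ with domain $D(L)$ (in $\mathbb{L}^2(\mu)$). $\mu$ is a probability measure on $E$ that is invariant and ergodic for $(P_t)$. $\mathbb{P}_\nu$ denotes the law of the process with initial distribution $\nu$. $\langle\cdot,\cdot\rangle_\mu$ is the inner product of $\mathbb{L}^2(\mu)$, $\mathrm{Var}_\mu(f)=\int f^2d\mu-(\int f d\mu)^2$, and $V^+=\max(V,0)$. Convention: $F(+\infty)=+\infty$. The right-hand side is $+\infty$ if $d\nu/d\mu\notin\mathbb{L}^2(\mu)$. *)

(* Defs.v *)
From HB Require Import structures.
From mathcomp Require Import all_boot all_order all_algebra.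
From mathcomp Require Import all_classical all_reals all_analysis.

Set Implicit Arguments.
Unset Strict Implicit.
Unset Printing Implicit Defensive.
Import Order.TTheory GRing.Theory Num.Theory.
Import numFieldNormedType.Exports.

Local Open Scope classical_set_scope.
Local Open Scope ring_scope.

Definition polish (R : realType) (E : completePseudoMetricType R) : Prop :=
  hausdorff_space E /\ exists2 D : set E, countable D & dense D.

Notation borel E := (g_sigma_algebraType (@open E)).

Section markov_process.
Context (R : realType) (dE dO : measure_display).
Context (E : measurableType dE) (Omega : measurableType dO).
Variables (X : R -> Omega -> E) (Px : R.-pker E ~> Omega).

Definition natural_filtration (s : R) : set (set Omega) :=
  <<s [set A | exists u (B : set E),
        [/\ 0 <= u <= s, measurable B & A = X u @^-1` B] ] >>.

(* X t is used for t >= 0 only. The process is conservative: X t takes its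
   values in E and every Px x is a probability measure. Joint measurability
   gives a meaning to the additive functionals \int_0^t V(X_s) ds.
   The Markov property is
     Px x (X_(s + t) \in B | F_s) = Px (X_s) (X_t \in B), Px x - a.s.,
   with the conditional probability written out. *)
Record is_markov_process : Prop := IsMarkovProcess {
  markov_measurable :
    measurable_fun ((`[0, +oo[%classic : set (measurableTypeR R)) `*` [set: Omega])
      (fun p : measurableTypeR R * Omega => X p.1 p.2) ;
  markov_start : forall x (B : set E), measurable B ->
    Px x (X 0 @^-1` B) = \d_x B ;
  markov_property : forall x s t (A : set Omega) (B : set E),
    0 <= s -> 0 <= t -> natural_filtration s A -> measurable B ->
    Px x (A `&` X (s + t) @^-1` B) =
    (\int[Px x]_(w in A) Px (X s w) (X t @^-1` B))%E
}.

Definition law_from (nu : probability E R) (A : set Omega) : \bar R :=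
  (\int[nu]_x Px x A)%E.

Definition semigroup (t : R) (f : E -> R) : E -> R :=
  fun x => \int[Px x]_w f (X t w).

Variable mu : probability E R.

Definition invariant_measure : Prop :=
  forall t (B : set E), 0 <= t -> measurable B ->
  law_from mu (X t @^-1` B) = mu B.

Definition ergodic : Prop :=
  forall B : set E, measurable B ->
  (forall t, 0 <= t -> {ae mu, forall x, Px x (X t @^-1` B) = \d_x B}) ->
  mu B = 0%E \/ mu B = 1%E.

Definition strongly_continuous : Prop :=
  forall f, f \in Lfun mu 2%:E ->
  'N[mu]_2%:E[EFin \o (semigroup t f \- f)%R]%E @[t --> 0^'+] --> 0%E.

(* g is the limit of (P_t f - f) / t in L^2(mu) as t -> 0+ *)
Definition is_generator (f g : E -> R) : Prop :=
  [/\ f \in Lfun mu 2%:E, g \in Lfun mu 2%:E &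
  'N[mu]_2%:E[EFin \o (fun x => t^-1 * (semigroup t f x - f x) - g x)%R]%E
    @[t --> 0^'+] --> 0%E].

Definition domL : set (E -> R) := [set f | exists g, is_generator f g].

(* a representative of the mu-a.e. class of L f *)
Definition genL (f : E -> R) : E -> R := xget (cst 0) (is_generator f).

End markov_process.

Definition inner (R : realType) d (T : measurableType d)
    (mu : probability T R) (f g : T -> R) : R := \int[mu]_x (f x * g x).

(* F maps [0, +oo[ to the reals, except that F 0 = -oo is allowed; values at
   negative arguments are irrelevant. *)
Record is_profile (R : realType) (F : R -> \bar R) : Prop := IsProfile {
  profile_fin : forall x, 0 < x -> F x \is a fin_num ;
  profile_cont : {within `[0, +oo[%classic, continuous F} ;
  profile_incr : forall x y, 0 <= x -> x < y -> (F x < F y)%E ;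
  profile_concave : forall p x y, 0 <= p <= 1 -> 0 <= x -> 0 <= y ->
    (p%:E * F x + (1 - p)%:E * F y <= F (p * x + (1 - p) * y)%R)%E ;
  profile_pinfty : F x @[x --> +oo] --> +oo%E ;
  profile1 : F 1 = 0%E ;
  profileM : forall x y, 0 < x -> 0 < y -> (F (x * y)%R <= F x + F y)%E
}.

(* inverse of F : ]0, +oo[ -> ]F 0, +oo[ *)
Definition Finv (R : realType) (F : R -> \bar R) (y : R) : R :=
  'pinv_(fun=> 0) `]0, +oo[%classic F y%:E.

(* F with the convention F(+oo) = +oo *)
Definition Fext (R : realType) (F : R -> \bar R) (x : \bar R) : \bar R :=
  match x with r%:E => F r | +oo => +oo | -oo => -oo end%E.

Section functional_inequalities.
Context (R : realType) (dE dO : measure_display).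
Context (E : measurableType dE) (Omega : measurableType dO).
Variables (X : R -> Omega -> E) (Px : R.-pker E ~> Omega).
Variable mu : probability E R.

Local Notation L := (genL X Px mu).

(* where f x = 0 and F 0 = -oo, the integrand is 0 * -oo = 0 *)
Definition F_sobolev (F : R -> \bar R) : Prop :=
  forall f, domL X Px mu f -> \int[mu]_x (f x ^+ 2) = 1 ->
  (\int[mu]_x ((f x ^+ 2)%:E * F (f x ^+ 2)%R) <= (- inner mu (L f) f)%:E)%E.

Definition poincare (CP : R) : Prop :=
  forall f, domL X Px mu f ->
  (variance mu f <= (- CP * inner mu (L f) f)%:E)%E.

(* The set is bounded above by lambda0. *)
Definition lambda1 (F : R -> \bar R) (CP lambda0 : R) (V : E -> R) : R :=
  sup [set l | 0 < l <= lambda0 /\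
    (Fext F (\int[mu]_x (Finv F (2 * l * V x *
                 \1_[set y | (4 * CP)^-1 < l * V y] x))%:E)
      <= ((4 * CP)^-1)%:E)%E].

End functional_inequalities.

(* Main.v *)
Require Import Defs.
From HB Require Import structures.
From mathcomp Require Import all_boot all_order all_algebra.
From mathcomp Require Import all_classical all_reals all_analysis.
From mathcomp Require Import measurable_realfun.
From mathcomp Require Import ring lra.

Set Implicit Arguments.
Unset Strict Implicit.
Unset Printing Implicit Defensive.
Import Order.TTheory GRing.Theory Num.Theory.
Import numFieldNormedType.Exports.

Local Open Scope classical_set_scope.
Local Open Scope ring_scope.
Local Open Scope charge_scope.

(** Why the theorem holds. Fix lam < lambda1 and put U = lam V, pretending first
that V is bounded. The Feynman-Kac functional phi_t(x) = E_x exp(int_0^t U(X_s) ds)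
solves d/dt phi_t = L phi_t + U phi_t, so that

  d/dt int phi_t^2 dmu = 2 (<L phi_t, phi_t> + int U phi_t^2 dmu).

If every f in the domain of L satisfies the form bound

  <L f, f> + int U f^2 dmu <= K int f^2 dmu,

Gronwall's lemma gives ||phi_t|| <= exp(K t) in L^2(mu). Integrating against nu
and using Cauchy-Schwarz for phi_t and dnu/dmu, then the exponential Markov
inequality, the probability of the event is at most
||dnu/dmu|| exp(- t (lam r - K)). This is [chernoff_bounded].

The form bound holds with K = 8 CP lam^2 m^2 ([form_bound]). Let a be the mean
of f, h = f - a, kappa = 1 / (4 CP) and D = - <L f, f>. In
U f^2 = a^2 U + 2 a U h + U h^2 the first term has mean 0. The second one is at
most 8 CP a^2 U^2 + h^2 / (8 CP), by Young's inequality; the part of the third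
one where U <= kappa is at most kappa h^2. By the Poincare inequality these two
terms in h^2 cost at most D/8 + D/4. The part of U h^2 where U > kappa is half
of the mean of W h^2, with W = 2 U 1_{U > kappa}, and the F-Sobolev inequality
bounds that mean by D + kappa int h^2 <= D + D/4. The total is at most D.

The F-Sobolev inequality acts on W through a duality ([profile_entropy_dual]).
Let z = F^{-1}(W), let I be the mean of z and p a slope of F at I. Then
F(xy) <= F(x) + F(y) and concavity give, with y = h^2 / int h^2,

  W = F(z) <= F(y) + F(z / y) <= F(y) + F(I) + p (z / y - I).

After multiplication by y the last term has mean 0, hence
int W y <= int y F(y) + F(I), and F(I) <= kappa is the condition that
defines lambda1.

Three points need care. The Markov property is given for one future time and
without shift operators, whereas phi_t is in the domain of L because
P_h phi_t = E_.(exp int_h^{h+t} U(X_s) ds), a statement about a whole path.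
It is deduced for products over time grids, and then for the exponential by
Riemann sums, which converge because s |-> U(X_s) is continuous in mean for the
stationary process ([path_L1_continuous], [exp_riemann], [fk_path_markov]). All
estimates are in L^1(mu), and boundedness turns them into L^2(mu) estimates.
Secondly, V is not bounded: it is truncated to [-n, k]. The lower truncation
raises the mean of V by at most m^2 / n; the upper one is removed by monotone
convergence at fixed n, at the price of a threshold slightly smaller than r
([law_deviation_event_le], [deviation_at]). Thirdly, the supremum over lam is
approached from the inside: lam is taken strictly below some l which satisfies
the condition, and F^{-1} is increasing on [0, +oo[. *)

(** * Bounded measurable functions *)

Section bounded_measurable.
Context {d} {T : measurableType d} {R : realType}.
Implicit Types f g : T -> R.

Definition bmeas f := measurable_fun [set: T] f /\ exists C, forall x, `|f x| <= C.

Lemma bmeas_cst c : bmeas (fun=> c).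
Proof. by split=> //; exists `|c|. Qed.

Lemma bmeasD f g : bmeas f -> bmeas g -> bmeas (fun x => f x + g x).
Proof.
move=> [mf [C fC]] [mg [D gD]]; split; first exact: measurable_funD.
by exists (C + D) => x; rewrite (le_trans (ler_normD _ _)) ?lerD.
Qed.

Lemma bmeasM f g : bmeas f -> bmeas g -> bmeas (fun x => f x * g x).
Proof.
move=> [mf [C fC]] [mg [D gD]]; split; first exact: measurable_funM.
by exists (C * D) => x; rewrite normrM ler_pM.
Qed.

Lemma bmeasN f : bmeas f -> bmeas (fun x => - f x).
Proof.
move=> [mf [C fC]]; split; first exact: measurableT_comp.
by exists C => x; rewrite normrN.
Qed.

Lemma bmeasB f g : bmeas f -> bmeas g -> bmeas (fun x => f x - g x).
Proof. by move=> bf bg; apply: bmeasD => //; exact: bmeasN. Qed.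

Lemma bmeas_norm f : bmeas f -> bmeas (fun x => `|f x|).
Proof.
move=> [mf [C fC]]; split; first exact: measurableT_comp.
by exists C => x; rewrite normr_id.
Qed.

Lemma bmeasX f n : bmeas f -> bmeas (fun x => f x ^+ n).
Proof.
move=> [mf [C fC]]; split; first exact: measurable_funX.
by exists (C ^+ n) => x; rewrite normrX lerXn2r ?nnegrE// (le_trans _ (fC x)).
Qed.

Lemma bmeas_exp f : bmeas f -> bmeas (fun x => expR (f x)).
Proof.
move=> [mf [C fC]]; split; first exact: measurableT_comp.
exists (expR C) => x; rewrite ger0_norm ?expR_ge0// ler_expR.
by rewrite (le_trans (ler_norm _)).
Qed.

Lemma bmeas_indic B : measurable B -> bmeas (\1_B).
Proof.
move=> mB; split=> //; exists 1 => x.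
by rewrite indicE; case: (x \in B); rewrite ?normr0 ?normr1.
Qed.

Lemma bmeas_pos f : bmeas f -> exists2 C, 0 < C & forall x, `|f x| <= C.
Proof.
move=> [_ [C fC]]; exists (`|C| + 1); first by rewrite ltr_wpDl.
by move=> x; rewrite (le_trans (fC x))// (le_trans (ler_norm C))// lerDl.
Qed.

(** Peel off one binary digit of f / e at a time: subtracting (e / 2) 1_{f >= e / 2}
does not change Phi f and halves the range of f. This is the measure-theoretic
induction for a functional which is only known to be linear and bounded in the
supremum norm, so that no monotone limit is available. *)
Lemma bmeas_ge0_functional0 (Phi : (T -> R) -> R) (K : R)
  (PhiD : forall f g, bmeas f -> bmeas g ->
    Phi (fun x => f x + g x) = Phi f + Phi g)
  (PhiZ : forall c f, bmeas f -> Phi (fun x => c * f x) = c * Phi f)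
  (PhiB : forall f e, bmeas f -> (forall x, `|f x| <= e) -> `|Phi f| <= K * e)
  (Phi1 : forall B, measurable B -> Phi (\1_B) = 0) n f (e : R) :
  measurable_fun setT f -> (forall x, 0 <= f x <= e) ->
  `|Phi f| <= K * (e * 2^-1 ^+ n).
Proof.
elim: n f e => [|n IH] f e mf fe.
  have fe' x : `|f x| <= e by move/andP : (fe x) => [f0 ?]; rewrite ger0_norm.
  by rewrite expr0 mulr1; apply: PhiB => //; split=> //; exists e.
pose B := f @^-1` `[e / 2, +oo[%classic.
have mB : measurable B by rewrite -(setTI B); exact: mf.
pose g x := f x - e / 2 * \1_B x.
have ge x : 0 <= g x <= e / 2.
  have := fe x; rewrite /g indicE; case: (boolP (x \in B)); last first.
    rewrite notin_setE/B/= in_itv/= andbT => /negP; rewrite -ltNge => h.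
    by rewrite mulr0 subr0; lra.
  by rewrite inE/B/= in_itv/= andbT mulr1 => h; lra.
have mg : measurable_fun setT g.
  by apply: measurable_funB => //; apply: measurable_funM.
have -> : f = (fun x => g x + e / 2 * \1_B x).
  by apply/funext => x; rewrite /g subrK.
have bg : bmeas g.
  by split=> //; exists (e / 2) => x; case/andP: (ge x) => *; rewrite ger0_norm.
have b1 := bmeas_indic mB.
rewrite PhiD ?PhiZ//; last by apply: bmeasM => //; exact: bmeas_cst.
rewrite Phi1// mulr0 addr0 (le_trans (IH g _ mg ge))//.
by rewrite exprS (mulrA e).
Qed.

(** The induction principle of the whole development: two bounded linear functionals
which agree on indicators agree on bounded measurable functions. *)
Lemma bmeas_functional0 (Phi : (T -> R) -> R) (K : R)
  (PhiD : forall f g, bmeas f -> bmeas g ->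
    Phi (fun x => f x + g x) = Phi f + Phi g)
  (PhiZ : forall c f, bmeas f -> Phi (fun x => c * f x) = c * Phi f)
  (PhiB : forall f e, bmeas f -> (forall x, `|f x| <= e) -> `|Phi f| <= K * e)
  (Phi1 : forall B, measurable B -> Phi (\1_B) = 0) f :
  bmeas f -> Phi f = 0.
Proof.
move=> bf; have [C C0 fC] := bmeas_pos bf.
(* Shift f to make it nonnegative. *)
have -> : f = (fun x => (f x + C) + (- C) * \1_[set: T] x).
  by apply/funext => x; rewrite indicT/=; lra.
have bfC : bmeas (fun x => f x + C) by apply: bmeasD => //; exact: bmeas_cst.
rewrite PhiD ?PhiZ ?Phi1 ?mulr0 ?addr0//; last 2 first.
- exact: bmeas_indic.
- by apply: bmeasM; [exact: bmeas_cst|exact: bmeas_indic].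
have H n := @bmeas_ge0_functional0 Phi K PhiD PhiZ PhiB Phi1 n
  (fun x => f x + C) (2 * C) bfC.1.
apply/normr0_eq0/eqP; rewrite eq_le normr_ge0 andbT.
have {}H n : `|Phi (fun x => f x + C)| <= K * (2 * C * 2^-1 ^+ n).
  by apply: H => x; have := fC x; rewrite ler_norml => ?; lra.
have : (fun n => K * (2 * C * 2^-1 ^+ n)) @ \oo --> K * (2 * C * 0).
  apply: cvgM; [exact: cvg_cst|apply: cvgM; [exact: cvg_cst|apply: cvg_expr]].
  by rewrite ger0_norm ?invr_ge0//; lra.
rewrite !mulr0 => cv0.
by apply: (ler_cvg_to (cvg_cst _) cv0); exact: nearW.
Qed.
End bounded_measurable.

(** * Means under probability measures and kernels *)

Lemma bmeas_integrable d (T : measurableType d) (R : realType)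
    (mu : {measure set T -> \bar R}) (D : set T) (f : T -> R) :
  measurable D -> (mu D < +oo)%E -> bmeas f -> mu.-integrable D (EFin \o f).
Proof.
move=> mD muD [mf [C fC]]; apply: measurable_bounded_integrable => //.
  exact: measurable_funTS.
exists C; split; first exact: num_real.
by move=> M CM x _ /=; rewrite (le_trans (fC x))// ltW.
Qed.

Lemma prob_measT d (T : measurableType d) (R : realType) (P : probability T R) :
  (P : {measure set T -> \bar R}) [set: T] = 1%E.
Proof. exact: probability_setT. Qed.

Section mean.
Context {d} {T : measurableType d} {R : realType} (P : {measure set T -> \bar R}).
Hypothesis P1 : P [set: T] = 1%E.
Implicit Types f g : T -> R.

Lemma bmeas_integrableP f : bmeas f -> P.-integrable [set: T] (EFin \o f).
Proof.
move=> bf; apply: bmeas_integrable => //.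
by rewrite P1 ltry.
Qed.
Let itg := bmeas_integrableP.

Lemma bmeas_EFin f : bmeas f -> (\int[P]_x (f x)%:E)%E = (\int[P]_x f x)%:E.
Proof. by move=> /itg/integrable_fin_num; rewrite /Rintegral => h; rewrite fineK// h. Qed.

Lemma meanD f g : bmeas f -> bmeas g ->
  \int[P]_x (f x + g x) = \int[P]_x f x + \int[P]_x g x.
Proof. by move=> bf bg; apply: RintegralD => //; exact: itg. Qed.

Lemma meanB f g : bmeas f -> bmeas g ->
  \int[P]_x (f x - g x) = \int[P]_x f x - \int[P]_x g x.
Proof. by move=> bf bg; apply: RintegralB => //; exact: itg. Qed.

Lemma meanZ c f : bmeas f -> \int[P]_x (c * f x) = c * \int[P]_x f x.
Proof. by move=> bf; apply: RintegralZl => //; exact: itg. Qed.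

Lemma mean_cst c : \int[P]_x c = c.
Proof. by rewrite Rintegral_cst// P1 mulr1. Qed.

Lemma mean_indic B : measurable B -> \int[P]_x \1_B x = fine (P B).
Proof. by move=> mB; rewrite /Rintegral integral_indic// setIT. Qed.

Lemma mean_le f g : bmeas f -> bmeas g -> (forall x, f x <= g x) ->
  \int[P]_x f x <= \int[P]_x g x.
Proof. by move=> bf bg fg; apply: le_Rintegral => //; exact: itg. Qed.

Lemma mean_norm f : bmeas f -> `|\int[P]_x f x| <= \int[P]_x `|f x|.
Proof. by move=> bf; apply: le_normr_Rintegral => //; exact: itg. Qed.

Lemma mean_ub f c : bmeas f -> (forall x, f x <= c) -> \int[P]_x f x <= c.
Proof.
by move=> bf fc; rewrite -[leRHS]mean_cst mean_le//; exact: bmeas_cst.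
Qed.

Lemma mean_bound f c : bmeas f -> (forall x, `|f x| <= c) -> `|\int[P]_x f x| <= c.
Proof.
move=> bf fc; apply: (le_trans (mean_norm bf)).
by apply: mean_ub => //; exact: bmeas_norm.
Qed.

Lemma mean_ge0 f : (forall x, 0 <= f x) -> 0 <= \int[P]_x f x.
Proof. by move=> f0; apply: Rintegral_ge0 => x _. Qed.

End mean.

#[global] Hint Resolve prob_measT : core.
#[global] Hint Extern 0 (_ = 1%E) => solve [exact: prob_kernel] : core.

Section bounded_operator.
Context {R : realType}.

(** The closure of these operators under composition reduces an identity between two
expressions built from kernels, paths and multiplications to its instances on
indicators, see [bop_eq]. *)
Record bop d1 d2 (T1 : measurableType d1) (T2 : measurableType d2)
    (A : (T1 -> R) -> T2 -> R) : Prop := Bop {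
  bop_bmeas : forall f, bmeas f -> bmeas (A f) ;
  bopD : forall f g y, bmeas f -> bmeas g ->
    A (fun x => f x + g x) y = A f y + A g y ;
  bopZ : forall c f y, bmeas f -> A (fun x => c * f x) y = c * A f y ;
  bop_bound : exists K, forall f e, bmeas f -> (forall x, `|f x| <= e) ->
    forall y, `|A f y| <= K * e
}.

Lemma bop_eq d1 d2 (T1 : measurableType d1) (T2 : measurableType d2)
    (A B : (T1 -> R) -> T2 -> R) : bop A -> bop B ->
  (forall D y, measurable D -> A (\1_D) y = B (\1_D) y) ->
  forall f, bmeas f -> forall y, A f y = B f y.
Proof.
move=> [Ab AD AZ [K AB]] [Bb BD BZ [L BB]] AB1 f bf y.
apply/eqP; rewrite -subr_eq0; apply/eqP.
apply: (@bmeas_functional0 _ _ _ (fun f => A f y - B f y) (K + L) _ _ _ _ f bf)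
    => [{bf}f g bf bg|c {bf}f bf|{bf}f e bf fe|D mD].
- by rewrite AD// BD// opprD addrACA.
- by rewrite AZ// BZ// mulrBr.
- by rewrite (le_trans (ler_normB _ _))// mulrDl lerD// ?AB// BB.
- by rewrite AB1// subrr.
Qed.

Lemma bop_comp d1 d2 d3 (T1 : measurableType d1) (T2 : measurableType d2)
    (T3 : measurableType d3) (A : (T1 -> R) -> T2 -> R) (B : (T2 -> R) -> T3 -> R) :
  bop A -> bop B -> bop (fun f => B (A f)).
Proof.
move=> [Ab AD AZ [K AB]] [Bb BD BZ [L BB]]; split.
- by move=> f bf; apply: Bb; exact: Ab.
- move=> f g y bf bg; rewrite -BD; [|exact: Ab..].
  by congr (B _ y); apply/funext => x; exact: AD.
- move=> c f y bf; rewrite -BZ; last exact: Ab.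
  by congr (B _ y); apply/funext => x; exact: AZ.
- exists (L * K) => f e bf fe y; rewrite -mulrA; apply: BB; first exact: Ab.
  exact: AB.
Qed.

Lemma bop_mul d1 (T1 : measurableType d1) (h : T1 -> R) : bmeas h ->
  bop (fun f x => h x * f x).
Proof.
move=> bh; split.
- by move=> f bf; exact: bmeasM.
- by move=> f g y bf bg; rewrite mulrDr.
- by move=> c f y bf; rewrite mulrCA.
- have [C C0 hC] := bmeas_pos bh; exists C => f e bf fe y.
  by rewrite normrM ler_pM.
Qed.

Lemma bmeas_comp d1 d2 (T1 : measurableType d1) (T2 : measurableType d2)
    (f : T2 -> R) (h : T1 -> T2) :
  measurable_fun setT h -> bmeas f -> bmeas (fun x => f (h x)).
Proof.
move=> mh [mf [C fC]]; split; first exact: measurableT_comp.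
by exists C.
Qed.

Lemma bop_precomp d1 d2 (T1 : measurableType d1) (T2 : measurableType d2)
    (h : T1 -> T2) : measurable_fun setT h -> bop (fun (f : T2 -> R) x => f (h x)).
Proof.
move=> mh; split=> //; first by move=> f; exact: bmeas_comp.
by exists 1 => f e bf fe y; rewrite mul1r.
Qed.

(** A mean is an operator into the functions on a one-point space, so that it
composes with the other operators. *)
Lemma bop_mean d1 (T1 : measurableType d1) (P : {measure set T1 -> \bar R}) :
  P setT = 1%E -> bop (fun f (_ : unit) => \int[P]_x f x).
Proof.
move=> P1; split.
- by move=> f bf; exact: bmeas_cst.
- by move=> f g y bf bg; rewrite meanD.
- by move=> c f y bf; rewrite meanZ.
- by exists 1 => f e bf fe y; rewrite mul1r; exact: mean_bound.
Qed.

End bounded_operator.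

Section kernel.
Context {R : realType} {dE dO : measure_display}.
Context {E : measurableType dE} {Omega : measurableType dO}.
Variable Px : R.-pker E ~> Omega.
Implicit Types f g : Omega -> R.

Lemma bmeas_kernel f : bmeas f -> bmeas (fun x => \int[Px x]_w f w).
Proof.
move=> bf; have [C C0 fC] := bmeas_pos bf.
split; last by exists C => x; exact: mean_bound.
have bfC : bmeas (fun w => f w + C) by apply: bmeasD => //; exact: bmeas_cst.
have -> : (fun x => \int[Px x]_w f w) =
          (fun x => fine (\int[Px x]_w (f w + C)%:E)%E - C).
  apply/funext => x; rewrite bmeas_EFin//= meanD//; last exact: bmeas_cst.
  by rewrite mean_cst// addrK.
apply: measurable_funB => //; apply: measurableT_comp => //=.
apply: measurable_fun_integral_kernel.
- by move=> U mU; exact: measurable_kernel.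
- by move=> w; rewrite lee_fin; have := fC w; rewrite ler_norml; lra.
- by apply/measurable_EFinP; exact: bfC.1.
Qed.

Lemma bop_kernel : bop (fun f x => \int[Px x]_w f w).
Proof.
split.
- exact: bmeas_kernel.
- by move=> f g y bf bg; rewrite meanD.
- by move=> c f y bf; rewrite meanZ.
- by exists 1 => f e bf fe y; rewrite mul1r; exact: mean_bound.
Qed.

Variable nu : probability E R.

Definition init_law : set Omega -> \bar R := law_from Px nu.

Let init_law0 : init_law set0 = 0%E.
Proof. by apply: integral0_eq => x _; rewrite measure0. Qed.

Let init_law_ge0 A : (0 <= init_law A)%E.
Proof. by apply: integral_ge0. Qed.

Let init_law_additive : semi_sigma_additive init_law.
Proof.
move=> F mF tF mUF; rewrite /init_law /law_from.
have -> : (\int[nu]_x Px x (\bigcup_n F n) = \sum_(n <oo) (\int[nu]_x Px x (F n)))%E.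
  rewrite -integral_nneseries//; last by move=> n; exact: measurable_kernel.
  apply: eq_integral => x _; apply/esym/cvg_lim => //.
  exact: measure_semi_sigma_additive.
by apply: is_cvg_nneseries => n _ _; apply: integral_ge0.
Qed.

HB.instance Definition _ := isMeasure.Build _ _ _ init_law
  init_law0 init_law_ge0 init_law_additive.

Let init_law_setT : init_law [set: Omega] = 1%E.
Proof.
rewrite /init_law /law_from; under eq_integral do rewrite prob_kernel.
by rewrite integral_cst// mul1e prob_measT.
Qed.

HB.instance Definition _ :=
  Measure_isProbability.Build _ _ _ init_law init_law_setT.

Lemma init_law_mass : init_law [set: Omega] = 1%E.
Proof. exact: init_law_setT. Qed.

Lemma init_law_mean f : bmeas f ->
  \int[init_law]_w f w = \int[nu]_x (\int[Px x]_w f w).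
Proof.
move=> bf.
have b1 := bop_mean (prob_measT init_law).
have b2 := bop_comp bop_kernel (bop_mean (prob_measT nu)).
apply: (bop_eq b1 b2 _ bf tt) => B _ mB /=.
rewrite mean_indic//.
under eq_Rintegral do rewrite mean_indic//.
rewrite /Rintegral; congr fine; apply: eq_integral => x _.
by rewrite fineK//; exact: finite_kernel_measure.
Qed.

End kernel.

#[global] Hint Extern 0 (_ = 1%E) => solve [exact: init_law_mass] : core.

(** * The Markov property for finite products along a path *)

Lemma bmeas_prod d (T : measurableType d) (R : realType) n (f : nat -> T -> R) :
  (forall i, bmeas (f i)) -> bmeas (fun w => \prod_(i < n) f i w).
Proof.
move=> bf; elim: n => [|n IH].
  by under eq_fun do rewrite big_ord0; exact: bmeas_cst.
by under eq_fun do rewrite big_ord_recr/=; exact: bmeasM.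
Qed.

Section markov.
Context {R : realType} {dE dO : measure_display}.
Context {E : measurableType dE} {Omega : measurableType dO}.
Variables (X : R -> Omega -> E) (Px : R.-pker E ~> Omega).
Hypothesis hX : is_markov_process X Px.

(** The process is only controlled at nonnegative times. Freezing it at time 0 for
negative times makes it jointly measurable on the whole line, as product
measures on the line require. *)
Lemma measurable_positive_path :
  measurable_fun setT
    (fun p : measurableTypeR R * Omega => X (Num.max p.1 0) p.2).
Proof.
pose D := (`[0, +oo[%classic : set (measurableTypeR R)) `*` [set: Omega].
apply: (@measurable_comp _ _ _ _ _ _ D
  (fun p : measurableTypeR R * Omega => X p.1 p.2) setT
  (fun p : measurableTypeR R * Omega => ((Num.max p.1 0 : measurableTypeR R), p.2))).
- by apply: measurableX => //; exact: measurable_itv.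
- move=> _ [p _ <-]; split=> //=.
  by rewrite in_itv/= andbT le_max lexx orbT.
- exact: markov_measurable hX.
- apply: measurable_fun_pair; last exact: measurable_snd.
  by apply: measurable_maxr; [exact: measurable_fst|exact: measurable_cst].
Qed.

Lemma measurable_path s : 0 <= s -> measurable_fun setT (X s).
Proof.
move=> s0; have := measurable_positive_path => m.
have := measurableT_comp m (@pair1_measurable _ _ (measurableTypeR R) Omega s).
by apply: eq_measurable_fun => w _ /=; rewrite (max_idPl s0).
Qed.

Lemma bmeas_path (f : E -> R) s : 0 <= s -> bmeas f -> bmeas (fun w => f (X s w)).
Proof. by move=> s0; apply: bmeas_comp; exact: measurable_path. Qed.

Lemma bmeas_semigroup (f : E -> R) t : 0 <= t -> bmeas f -> bmeas (semigroup X Px t f).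
Proof. by move=> t0 bf; apply: bmeas_kernel; exact: bmeas_path. Qed.

(** X_0 = x almost surely under P_x, but only the law of X_0 is given: the
difference of the two integrands vanishes off the event f(X_0) <> f(x), which
is null. *)
Lemma start_mean (f : E -> R) (Z : Omega -> R) x : bmeas f -> bmeas Z ->
  \int[Px x]_w (f (X 0 w) * Z w) = f x * \int[Px x]_w Z w.
Proof.
move=> bf bZ; have [C C0 fC] := bmeas_pos bf; have [D D0 ZD] := bmeas_pos bZ.
have b0 := bmeas_path (lexx 0) bf.
have bp : bmeas (fun w => f (X 0 w) * Z w) by exact: bmeasM.
rewrite -(meanZ (prob_kernel x))//; apply/eqP; rewrite -subr_eq0 -meanB//; last first.
  by apply: bmeasM => //; exact: bmeas_cst.
set g := (fun w => _).
have bg : bmeas g by apply: bmeasB => //; apply: bmeasM => //; exact: bmeas_cst.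
pose B := f @^-1` [set~ f x].
have mB : measurable B by rewrite -(setTI B); apply: bf.1 => //; exact: measurableC.
have bB : bmeas (fun w => 2 * C * D * \1_B (X 0 w)).
  apply: bmeasM; first exact: bmeas_cst.
  by apply: bmeas_path => //; exact: bmeas_indic.
rewrite -normr_eq0 eq_le normr_ge0 andbT (le_trans (mean_norm (prob_kernel x) bg))//.
apply: (@le_trans _ _ (\int[Px x]_w (2 * C * D * \1_B (X 0 w)))).
  apply: mean_le => //; first exact: bmeas_norm.
  move=> w; rewrite /g -mulrBl normrM indicE.
  have [->|ne] := eqVneq (f (X 0 w)) (f x).
    by rewrite subrr normr0 mul0r !mulr_ge0// ltW.
  have -> : X 0 w \in B by rewrite inE; exact/eqP.
  rewrite mulr1 ler_pM// (le_trans (ler_normB _ _))//.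
  by have := fC x; have := fC (X 0 w); lra.
rewrite meanZ//; last by apply: bmeas_path => //; exact: bmeas_indic.
have -> : (fun w => \1_B (X 0 w)) = (\1_(X 0 @^-1` B) : Omega -> R) by [].
rewrite mean_indic; last first.
  rewrite -[X in measurable X]setTI.
  exact: (measurable_path (lexx 0)).
rewrite (markov_start hX)// diracE memNset ?mulr0//.
by move=> /=; apply.
Qed.

Definition past_events s : set (set Omega) :=
  [set A | exists u (B : set E),
        [/\ 0 <= u <= s, measurable B & A = X u @^-1` B] ].
(** Omega with the natural sigma-algebra of the process at time s, so that being
measurable with respect to the past is measurability on this space. *)
Definition past s := g_sigma_algebraType (past_events s).

Lemma past_measurable s (A : set Omega) :
  (measurable : set (set (past s))) A -> measurable A.
Proof.
apply: smallest_sub; first exact: sigma_algebra_measurable.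
move=> _ [u [B [/andP[u0 us] mB ->]]].
by rewrite -[X in measurable X]setTI; exact: (measurable_path u0).
Qed.

Lemma bmeas_past s (Y : past s -> R) : bmeas Y -> bmeas (Y : Omega -> R).
Proof.
move=> [mY [C YC]]; split; last by exists C.
by move=> _ B mB; apply: (@past_measurable s); exact: mY.
Qed.

Lemma bmeas_past_le s t (Y : Omega -> R) : s <= t ->
  bmeas (Y : past s -> R) -> bmeas (Y : past t -> R).
Proof.
move=> st [mY [C YC]]; split; last by exists C.
move=> _ B mB; have := mY measurableT B mB.
apply: sub_sigma_algebra2 => _ [u [A [/andP[u0 us] mA ->]]].
by exists u, A; rewrite u0 (le_trans us).
Qed.

Lemma bmeas_past_path s u (f : E -> R) : 0 <= u <= s -> bmeas f ->
  bmeas ((fun w => f (X u w)) : past s -> R).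
Proof.
move=> us [mf [C fC]]; split; last by exists C.
move=> _ B mB; rewrite setTI; apply: sub_sigma_algebra.
exists u, (f @^-1` B); split=> //.
by rewrite -[X in measurable X]setTI; exact: mf.
Qed.

Lemma bop_semigroup t : 0 <= t -> bop (semigroup X Px t).
Proof.
by move=> t0; exact: bop_comp (bop_precomp (measurable_path t0)) (bop_kernel Px).
Qed.

(** The Markov property, extended from indicators to functions of the future state. *)
Lemma markov_event x s t (f : E -> R) (A : set Omega) : 0 <= s -> 0 <= t ->
  natural_filtration X s A -> bmeas f ->
  \int[Px x]_w (\1_A w * f (X (s + t) w)) =
  \int[Px x]_w (\1_A w * semigroup X Px t f (X s w)).
Proof.
move=> s0 t0 FA bf; have mA : measurable A by exact: (@past_measurable s).
have st0 : 0 <= s + t by exact: addr_ge0.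
have bA := bop_comp (bop_mul (@bmeas_indic _ _ R _ mA)) (bop_kernel Px).
have b1 := bop_comp (bop_precomp (measurable_path st0)) bA.
have b2 := bop_comp (bop_comp (bop_semigroup t0) (bop_precomp (measurable_path s0))) bA.
apply: (bop_eq b1 b2 _ bf x) => B {}x mB /=.
have mXB u : 0 <= u -> measurable (X u @^-1` B).
  by move=> u0; rewrite -[X in measurable X]setTI; exact: (measurable_path u0).
have -> : (fun w => \1_A w * \1_B (X (s + t) w)) =
          \1_(A `&` X (s + t) @^-1` B) :> (Omega -> R).
  by apply/funext => w; rewrite indicI.
rewrite mean_indic; last by apply: measurableI => //; exact: mXB.
rewrite (markov_property hX)// /Rintegral; congr fine.
rewrite integral_mkcond; apply: eq_integral => w _.
rewrite patchE indicE; case: (w \in A); last by rewrite mul0r.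
rewrite mul1r /semigroup.
have -> : (fun w => \1_B (X t w)) = (\1_(X t @^-1` B) : Omega -> R) by [].
by rewrite mean_indic ?fineK//; [apply: finite_kernel_measure|..]; exact: mXB.
Qed.

Lemma bop_past s : bop (fun (Y : past s -> R) (w : Omega) => Y w).
Proof.
split=> //; first exact: bmeas_past.
by exists 1 => f e bf fe y; rewrite mul1r.
Qed.

Lemma bop_mulr d1 (T1 : measurableType d1) (h : T1 -> R) : bmeas h ->
  bop (fun f x => f x * h x).
Proof.
move=> /bop_mul; have -> // : (fun f x => h x * f x) = (fun f x => f x * h x).
by apply/funext => f; apply/funext => x; rewrite mulrC.
Qed.

(** The Markov property, extended also from events of the past to functions of the
past. *)
Lemma markov_mean x s t (f : E -> R) (Y : Omega -> R) : 0 <= s -> 0 <= t ->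
  bmeas (Y : past s -> R) -> bmeas f ->
  \int[Px x]_w (Y w * f (X (s + t) w)) =
  \int[Px x]_w (Y w * semigroup X Px t f (X s w)).
Proof.
move=> s0 t0 bY bf; have st0 : 0 <= s + t by exact: addr_ge0.
have bf1 := bmeas_path st0 bf.
have bf2 := bmeas_path s0 (bmeas_semigroup t0 bf).
have b1 := bop_comp (bop_comp (bop_past s) (bop_mulr bf1)) (bop_kernel Px).
have b2 := bop_comp (bop_comp (bop_past s) (bop_mulr bf2)) (bop_kernel Px).
apply: (bop_eq b1 b2 _ bY x) => A {}x mA /=.
exact: markov_event.
Qed.

Section discrete_path.
Variables (g : E -> R) (delta : R).
Hypotheses (bg : bmeas g) (delta0 : 0 <= delta).

(** The iterated operator f |-> g P_delta f; see [transfer_past] for the expectation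
along a path that it computes. *)
Fixpoint transfer n : E -> R :=
  if n is n'.+1 then fun x => g x * semigroup X Px delta (transfer n') x
  else fun=> 1.

Lemma bmeas_transfer n : bmeas (transfer n).
Proof.
elim: n => [|n IH]; first exact: bmeas_cst.
by apply: bmeasM => //; exact: bmeas_semigroup.
Qed.

(** The Markov property applied to the grid points from the last one to the first:
at each step the first factor joins the past Y, and the induction hypothesis is
used at the later starting time s + delta. *)
Lemma transfer_past n x s (Y : Omega -> R) : 0 <= s -> bmeas (Y : past s -> R) ->
  \int[Px x]_w (Y w * \prod_(i < n) g (X (s + i%:R * delta) w)) =
  \int[Px x]_w (Y w * transfer n (X s w)).
Proof.
elim: n s Y => [|n IH] s Y s0 bY.
  by apply: eq_Rintegral => w _; rewrite big_ord0.
have sd : s <= s + delta by rewrite lerDl.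
have sd0 : 0 <= s + delta by exact: le_trans sd.
transitivity (\int[Px x]_w ((Y w * g (X s w)) *
    \prod_(i < n) g (X (s + delta + i%:R * delta) w))).
  apply: eq_Rintegral => w _; rewrite big_ord_recl/= mul0r addr0 mulrA.
  congr (_ * _); apply: eq_bigr => i _; congr (g (X _ w)).
  by rewrite /bump/= natrD; lra.
rewrite IH//; last first.
  apply: (@bmeasM _ (past (s + delta)) R) => //.
    exact: bmeas_past_le bY.
  by apply: bmeas_past_path => //; rewrite s0.
rewrite markov_mean//; last 2 first.
- apply: (@bmeasM _ (past s) R) => //.
  by apply: bmeas_past_path => //; rewrite s0/=.
- exact: bmeas_transfer.
by apply: eq_Rintegral => w _; rewrite -mulrA.
Qed.

(** No shift operators on Omega are given; for a functional of finitely many times,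
the one-time Markov property does their work: running the process from time h is
the same as restarting it from X_h. *)
Lemma discrete_shift n x h : 0 <= h ->
  \int[Px x]_w (\prod_(i < n) g (X (h + i%:R * delta) w)) =
  semigroup X Px h (fun y => \int[Px y]_w (\prod_(i < n) g (X (i%:R * delta) w))) x.
Proof.
move=> h0.
have c1 s : bmeas ((fun=> 1) : past s -> R) by exact: bmeas_cst.
have E1 : (fun y => \int[Px y]_w (\prod_(i < n) g (X (i%:R * delta) w))) = transfer n.
  apply/funext => y; have := transfer_past n y (lexx 0) (c1 0).
  under eq_Rintegral.
    move=> w _; rewrite mul1r; under eq_bigr do rewrite add0r.
    over.
  move=> ->; under eq_Rintegral do rewrite mulrC.
  by rewrite start_mean; [rewrite mean_cst ?mulr1//|exact: bmeas_transfer|exact: bmeas_cst].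
rewrite E1; have := transfer_past n x h0 (c1 h).
under eq_Rintegral do rewrite mul1r.
by move=> ->; apply: eq_Rintegral => w _; rewrite mul1r.
Qed.

End discrete_path.
End markov.

(** * Convergence in L^2(mu) as time decreases to 0 *)

Lemma near_at_right0P (R : realType) (P : R -> Prop) :
  (\forall t \near 0^'+, P t) <->
  exists2 h0 : R, 0 < h0 & forall h : R, 0 < h -> h <= h0 -> P h.
Proof.
split=> [[e /= e0 eP]|[h0 h00 hP]].
  exists (e / 2); first by rewrite divr_gt0.
  move=> h h1 he; apply: eP => //=; rewrite sub0r normrN gtr0_norm//.
  by rewrite (le_lt_trans he)// ltr_pdivrMr// ltr_pMr// ltr1n.
exists h0 => // h /=; rewrite sub0r normrN => hh h1; apply: hP => //.
by rewrite -[leLHS]gtr0_norm// ltW.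
Qed.

Lemma cvg_at_right0P (R : realType) (N : R -> \bar R) : (forall h, 0 <= N h)%E ->
  (N h @[h --> 0^'+] --> 0%E) <->
  forall e : R, 0 < e -> exists2 h0 : R, 0 < h0 & forall h : R, 0 < h -> h <= h0 -> (N h <= e%:E)%E.
Proof.
move=> N0; split=> [cN e e0|H].
  have nb : nbhs 0%E [set y : \bar R | (y <= e%:E)%E].
    have : nbhs 0%E [set y : \bar R | (y < e%:E)%E].
      by apply: open_nbhs_nbhs; split; [exact: open_ereal_lt_ereal|rewrite /= lte_fin].
    by apply: filterS => y /= /ltW.
  exact: (near_at_right0P _).1 (cN _ nb).
apply/fine_cvgP; split.
  have [h0 h00 hN] := H 1 ltr01; apply/near_at_right0P; exists h0 => // h h1 h2.
  by rewrite ge0_fin_numE// (le_lt_trans (hN _ h1 h2))// ltry.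
apply/cvgrPdist_le => e e0; have [h0 h00 hN] := H e e0.
apply/near_at_right0P; exists h0 => // h h1 h2 /=; rewrite sub0r normrN.
have Nh := hN h h1 h2.
have fN : N h \is a fin_num by rewrite ge0_fin_numE// (le_lt_trans Nh)// ltry.
by rewrite ger0_norm ?fine_ge0// -lee_fin fineK.
Qed.

Section Lnorm2.
Context {d} {T : measurableType d} {R : realType}.
Variable mu : probability T R.

Lemma Lnorm2_sqr (f : T -> R) :
  ('N[mu]_2%:E[EFin \o f] `^ 2 = \int[mu]_x (f x ^+ 2)%:E)%E.
Proof.
rewrite poweR_Lnorm//; apply: eq_integral => x _.
by rewrite /= powR_mulrn// real_normK// num_real.
Qed.

Lemma Lnorm2_le (f : T -> R) (e : R) : 0 <= e ->
  ('N[mu]_2%:E[EFin \o f] <= e%:E)%E = (\int[mu]_x (f x ^+ 2)%:E <= (e ^+ 2)%:E)%E.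
Proof.
move=> e0; rewrite -Lnorm2_sqr.
have e2 : ((e ^+ 2)%:E = e%:E `^ 2)%E by rewrite poweR_EFin powR_mulrn.
apply/idP/idP; rewrite e2.
  by move=> h; apply: gt0_ler_poweR => //; rewrite in_itv/= ?Lnorm_ge0 ?lee_fin ?e0 leey.
move=> h.
have inv2 (x : \bar R) : (0 <= x -> (x `^ 2) `^ 2^-1 = x)%E.
  by move=> x0; rewrite -poweRrM divff// poweRe1.
rewrite -[leLHS]inv2 ?Lnorm_ge0// -[leRHS]inv2 ?lee_fin//.
by apply: gt0_ler_poweR => //; rewrite in_itv/= leey andbT ?lee_fin ?powR_ge0 ?poweR_ge0.
Qed.

(** Integrate |f| <= e / 2 + f^2 / (2 e), which avoids any integrability
hypothesis on f. *)
Lemma abs_mean_le (f : T -> R) (e : R) : 0 < e -> measurable_fun setT f ->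
  (\int[mu]_x (f x ^+ 2)%:E <= (e ^+ 2)%:E)%E -> (\int[mu]_x `|f x|%:E <= e%:E)%E.
Proof.
move=> e0 mf h.
have m2 : measurable_fun setT (fun x => (f x ^+ 2)%:E).
  by apply/measurable_EFinP; exact: measurable_funX.
apply: (@le_trans _ _ (\int[mu]_x ((e / 2)%:E + (2 * e)^-1%:E * (f x ^+ 2)%:E))%E).
  apply: ge0_le_integral => //.
  - by apply/measurable_EFinP; exact: measurableT_comp.
  - by apply: emeasurable_funD => //; exact: measurable_funeM.
  - move=> x _; rewrite -EFinM -EFinD lee_fin.
    rewrite -subr_ge0.
    have -> : e / 2 + (2 * e)^-1 * f x ^+ 2 - `|f x| = (e - `|f x|) ^+ 2 / (2 * e).
      rewrite -(real_normK (num_real (f x))); field.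
      by rewrite gt_eqF.
    by rewrite divr_ge0 ?sqr_ge0// ltW// mulr_gt0.
have p1 : 0 <= (2 * e)^-1 by rewrite invr_ge0 ltW// mulr_gt0.
have p2 : 0 <= e / 2 by rewrite divr_ge0// ltW.
have f2 x : (0 <= (f x ^+ 2)%:E)%E by rewrite lee_fin sqr_ge0.
rewrite ge0_integralD//; [|by move=> x _; rewrite mule_ge0|exact: measurable_funeM].
rewrite integral_cst// prob_measT mule1 ge0_integralZl//.
apply: (@le_trans _ _ ((e / 2)%:E + (2 * e)^-1%:E * (e ^+ 2)%:E)%E).
  by apply: leeD => //; apply: lee_wpmul2l => //.
rewrite -EFinM -EFinD lee_fin le_eqVlt; apply/orP; left; apply/eqP; field.
by rewrite gt_eqF.
Qed.

Lemma Lnorm2_cvg0_abs_mean (g : R -> T -> R) :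
  (forall h : R, 0 < h -> measurable_fun setT (g h)) ->
  'N[mu]_2%:E[EFin \o g h]%E @[h --> 0^'+] --> 0%E ->
  forall e : R, 0 < e -> exists2 h0 : R, 0 < h0 &
    forall h : R, 0 < h -> h <= h0 -> (\int[mu]_x `|g h x|%:E <= e%:E)%E.
Proof.
move=> mg /cvg_at_right0P H e e0; have [|h0 h00 hP] := H _ e e0.
  by move=> h; exact: Lnorm_ge0.
exists h0 => // h h1 h2; apply: abs_mean_le => //; first exact: mg.
by rewrite -Lnorm2_le ?(ltW e0)//; exact: hP.
Qed.

Lemma mean_null_mul (k f : T -> R) : bmeas k -> bmeas f ->
  \int[mu]_x `|k x| = 0 -> \int[mu]_x (k x * f x) = 0.
Proof.
move=> bk bf k0; have [D D0 fD] := bmeas_pos bf.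
have bkf := bmeasM bk bf; have bnk := bmeas_norm bk.
apply/eqP; rewrite -normr_eq0 eq_le normr_ge0 andbT.
apply: (le_trans (mean_norm (prob_measT mu) bkf)).
apply: (@le_trans _ _ (\int[mu]_x (D * `|k x|))).
  apply: mean_le => //; first exact: bmeas_norm.
    by apply: bmeasM => //; exact: bmeas_cst.
  by move=> x; rewrite normrM mulrC ler_wpM2r.
by rewrite meanZ// k0 mulr0.
Qed.

Lemma mean_sqr_ae (f f' : T -> R) : bmeas f -> bmeas f' ->
  \int[mu]_x `|f x - f' x| = 0 -> \int[mu]_x (f x ^+ 2) = \int[mu]_x (f' x ^+ 2).
Proof.
move=> bf bf' ff'; have bd := bmeasB bf bf'; have bs := bmeasD bf bf'.
have := mean_null_mul bd bs ff'.
under eq_Rintegral do rewrite -subr_sqr.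
rewrite meanB//; [|exact: bmeasX..].
by move=> /eqP; rewrite subr_eq0 => /eqP.
Qed.

Lemma mean_abs_ae (f f' : T -> R) : bmeas f -> bmeas f' ->
  \int[mu]_x `|f x - f' x| = 0 -> \int[mu]_x `|f' x| <= \int[mu]_x `|f x|.
Proof.
move=> bf bf' ff'; have bd := bmeas_norm (bmeasB bf bf').
have b1 := bmeas_norm bf; have b2 := bmeas_norm bf'.
rewrite -[leRHS]addr0 -ff' -meanD//; apply: mean_le => //; first exact: bmeasD.
move=> x; have := ler_normB (f x) (f x - f' x).
by rewrite opprB addrC subrK.
Qed.

(** L^1 convergence to 0 of a bounded family implies L^2 convergence. The bound is
only required of an almost everywhere equal family g': the difference quotients
of the semigroup are identified with those of a bounded functional up to null
sets. *)
Lemma bounded_Lnorm2_cvg0 (g g' : R -> T -> R) (K : R) : 0 < K ->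
  (forall h : R, 0 < h -> bmeas (g h)) ->
  (exists2 h1 : R, 0 < h1 & forall h : R, 0 < h -> h <= h1 ->
    [/\ bmeas (g' h), (forall x, `|g' h x| <= K) &
        \int[mu]_x `|g h x - g' h x| = 0]) ->
  (forall e : R, 0 < e -> exists2 h0 : R, 0 < h0 &
    forall h : R, 0 < h -> h <= h0 -> \int[mu]_x `|g h x| <= e) ->
  'N[mu]_2%:E[EFin \o g h]%E @[h --> 0^'+] --> 0%E.
Proof.
move=> K0 bg [h1 h10 gK] H; apply/cvg_at_right0P => [h|e e0]; first exact: Lnorm_ge0.
have [|h0 h00 hP] := H (e ^+ 2 / K); first by rewrite divr_gt0 ?exprn_gt0.
exists (Num.min h0 h1); first by rewrite lt_min h00.
move=> h hp; rewrite le_min => /andP[hh0 hh1].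
have [bg' g'K gg'] := gK h hp hh1; have bgh := bg h hp.
rewrite Lnorm2_le ?(ltW e0)// bmeas_EFin//; last exact: bmeasX.
rewrite lee_fin (mean_sqr_ae bgh bg' gg').
apply: (@le_trans _ _ (\int[mu]_x (K * `|g' h x|))).
  apply: mean_le => //; first exact: bmeasX.
    by apply: bmeasM; [exact: bmeas_cst|exact: bmeas_norm].
  by move=> x; rewrite -(real_normK (num_real _)) expr2 ler_pM.
rewrite meanZ//; last exact: bmeas_norm.
by rewrite mulrC -ler_pdivlMr// (le_trans (mean_abs_ae bgh bg' gg'))// hP.
Qed.

End Lnorm2.

(** * Time integrals of bounded processes *)

Section time_integral.
Context {R : realType} {d} {Omega : measurableType d}.
Implicit Types y : R -> Omega -> R.
Local Notation leb := (@lebesgue_measure R).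

Definition jointly_bmeas y :=
  bmeas (fun p : measurableTypeR R * Omega => y p.1 p.2).

Definition tint y (a b : R) (w : Omega) : R := \int[leb]_(r in `[a, b]) y r w.

Lemma jointly_bmeas_time y w : jointly_bmeas y ->
  bmeas (fun r : measurableTypeR R => y r w).
Proof. by move=> jy; apply: (bmeas_comp (@pair2_measurable _ _ (measurableTypeR R) _ w) jy). Qed.

Lemma jointly_bmeas_at y r : jointly_bmeas y -> bmeas (y r).
Proof. by move=> jy; apply: (bmeas_comp (@pair1_measurable _ _ (measurableTypeR R) _ r) jy). Qed.

Lemma lebesgue_itvcc (a b : R) : a <= b ->
  (leb : {measure set (measurableTypeR R) -> \bar R}) `[a, b]%classic = (b - a)%:E.
Proof.
move=> ab; suff: leb `[a, b]%classic = (b - a)%:E by [].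
rewrite lebesgue_measure_itv/= lte_fin.
by move: ab; rewrite le_eqVlt => /predU1P[->|->]; rewrite ?ltxx ?subrr// EFinB.
Qed.

Lemma itv_integrable y a b w : jointly_bmeas y -> a <= b ->
  leb.-integrable `[a, b] (EFin \o (fun r => y r w)).
Proof.
move=> jy ab; apply: bmeas_integrable => //.
- by rewrite lebesgue_itvcc// ltry.
- exact: jointly_bmeas_time.
Qed.

Lemma itv_integrable_cst c a b : a <= b -> leb.-integrable `[a, b] (EFin \o (fun=> c)).
Proof.
by move=> ab; apply: bmeas_integrable => //; [rewrite lebesgue_itvcc// ltry|exact: bmeas_cst].
Qed.

Lemma Rintegral_itv_cst c a b : a <= b -> \int[leb]_(r in `[a, b]) c = c * (b - a).
Proof. by move=> ab; rewrite Rintegral_cst// lebesgue_itvcc. Qed.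

Lemma tintE y a b w : jointly_bmeas y -> a <= b ->
  ((tint y a b w)%:E = \int[leb]_r (y r w * \1_(`[a, b]%classic) r)%:E)%E.
Proof.
move=> jy ab; rewrite /tint /Rintegral fineK; last first.
  exact/integrable_fin_num/itv_integrable.
rewrite integral_mkcond; apply: eq_integral => r _.
by rewrite patchE indicE; case: (r \in _); rewrite ?mulr1 ?mulr0.
Qed.

Lemma tint_bound y a b w C : jointly_bmeas y -> a <= b ->
  (forall r w, `|y r w| <= C) -> `|tint y a b w| <= C * (b - a).
Proof.
move=> jy ab yC; rewrite (le_trans (le_normr_Rintegral _ _))//.
  exact: itv_integrable.
rewrite -Rintegral_itv_cst//; apply: le_Rintegral => //.
- exact/integrable_norm/itv_integrable.
- exact: itv_integrable_cst.
Qed.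

Lemma tint_indic_measurable y a b : jointly_bmeas y ->
  measurable_fun setT (fun p : measurableTypeR R * Omega =>
    (y p.1 p.2 * \1_(`[a, b]%classic) p.1)%:E).
Proof.
move=> [my _]; apply/measurable_EFinP; apply: measurable_funM => //.
by apply: measurableT_comp => //; exact: measurable_indic.
Qed.

Lemma tint_shift y a b w C : jointly_bmeas y -> a <= b ->
  tint (fun r w => y r w + C) a b w = tint y a b w + C * (b - a).
Proof.
move=> jy ab; rewrite /tint RintegralD//; first by rewrite Rintegral_itv_cst.
- exact: itv_integrable.
- exact: itv_integrable_cst.
Qed.

(** Tonelli's theorem gives measurability for nonnegative integrands, hence the
shift of y by its bound. *)
Lemma bmeas_tint y a b : jointly_bmeas y -> a <= b -> bmeas (tint y a b).
Proof.
move=> jy ab; have [C C0 yC] := bmeas_pos jy.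
have yC' r w : `|y r w| <= C := yC (r, w).
split; last by exists (C * (b - a)) => w; exact: tint_bound.
have jyC : jointly_bmeas (fun r w => y r w + C).
  by apply: bmeasD => //; exact: bmeas_cst.
have -> : tint y a b = (fun w => fine
    (\int[leb]_r ((y r w + C) * \1_(`[a, b]%classic) r)%:E)%E - C * (b - a)).
  by apply/funext => w; rewrite -(tintE w jyC)//= tint_shift// addrK.
apply: measurable_funB => //; apply: measurableT_comp => //=.
apply: (@measurable_fun_fubini_tonelli_G _ _ (measurableTypeR R) Omega R leb
  (fun p => ((y p.1 p.2 + C) * \1_(`[a, b]%classic) p.1)%:E)).
  exact: (tint_indic_measurable a b jyC).
move=> [r w] /=; rewrite lee_fin mulr_ge0//.
by have := yC' r w; rewrite ler_norml; lra.
Qed.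

Lemma tint_split y a b c w : jointly_bmeas y -> a <= b -> b <= c ->
  tint y a c w = tint y a b w + tint y b c w.
Proof.
move=> jy ab bc; have ac := le_trans ab bc.
have iac := itv_integrable w jy ac.
have := @Rintegral_itvB _ (fun r => y r w) (BLeft a) (BRight c) b iac.
rewrite !bnd_simp => /(_ ab bc).
rewrite Rintegral_itv_obnd_cbnd => [H|].
  by rewrite /tint -H addrC subrK.
apply: integrableS (itv_integrable w jy bc) => //.
by apply: subset_itvr; rewrite bnd_simp.
Qed.

Lemma mean_tint_le (P : probability Omega R) y a b e : jointly_bmeas y ->
  a <= b -> (forall r w, 0 <= y r w) ->
  (forall r, a <= r <= b -> \int[P]_w y r w <= e) ->
  \int[P]_w tint y a b w <= e * (b - a).
Proof.
move=> jy ab y0 ye; have bt := bmeas_tint jy ab.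
rewrite -lee_fin -bmeas_EFin//.
under eq_integral do rewrite (tintE _ jy ab).
have m1 := tint_indic_measurable a b jy.
pose f (p : measurableTypeR R * Omega) := (y p.1 p.2 * \1_(`[a, b]%classic) p.1)%:E.
have f0 p : (0 <= f p)%E by rewrite lee_fin mulr_ge0.
have := @fubini_tonelli _ _ (measurableTypeR R) Omega R leb P f m1 f0.
rewrite /f /= => <-.
apply: (@le_trans _ _ (\int[leb]_(r in `[a, b]) e%:E)%E); last first.
  by rewrite integral_cst//= lebesgue_itvcc.
rewrite [leRHS]integral_mkcond; apply: ge0_le_integral => //=.
- by move=> r _; apply: integral_ge0 => w _; rewrite lee_fin mulr_ge0.
- exact: (@measurable_fun_fubini_tonelli_F _ _ (measurableTypeR R) Omega R P f m1 f0).
- by apply/(measurable_restrictT _ _).1.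
- move=> r _; rewrite patchE indicE; case: ifPn => rab.
    under eq_integral do rewrite mulr1.
    rewrite bmeas_EFin//; last exact: jointly_bmeas_at.
    by rewrite lee_fin; apply: ye; move: rab; rewrite inE/= in_itv.
  by under eq_integral do rewrite mulr0; rewrite integral0.
Qed.

(** Closeness in mean at each time passes to the time integral by Tonelli's theorem. *)
Lemma mean_abs_tintB_le (P : probability Omega R) y (z : Omega -> R) a b e :
  jointly_bmeas y -> bmeas z -> a <= b ->
  (forall r, a <= r <= b -> \int[P]_w `|y r w - z w| <= e) ->
  \int[P]_w `|tint y a b w - (b - a) * z w| <= e * (b - a).
Proof.
move=> jy bz ab H.
have jz : jointly_bmeas (fun _ => z) by apply: bmeas_comp bz; exact: measurable_snd.
have jyz : jointly_bmeas (fun r w => y r w - z w) by exact: bmeasB.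
have jd : jointly_bmeas (fun r w => `|y r w - z w|) by exact: bmeas_norm.
apply: le_trans (mean_tint_le jd ab _ H) => //.
apply: mean_le => //.
- apply: bmeas_norm; apply: bmeasB; first exact: bmeas_tint.
  by apply: bmeasM => //; exact: bmeas_cst.
- exact: bmeas_tint.
- move=> w.
  have -> : tint y a b w - (b - a) * z w = \int[leb]_(r in `[a, b]) (y r w - z w).
    rewrite RintegralB//; [|exact: itv_integrable|exact: itv_integrable_cst].
    by rewrite Rintegral_itv_cst// mulrC.
  by apply: le_normr_Rintegral => //; exact: (itv_integrable w jyz ab).
Qed.

End time_integral.

(** * The stationary process *)

(** Crude, but the square is all that matters: it makes the second order terms
negligible with respect to the time step. *)
Lemma expR_taylor1 (R : realType) (a : R) :
  `|expR a - 1 - a| <= a ^+ 2 * expR `|a|.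
Proof.
have h1 : expR a - 1 <= a * expR a.
  have := expR_ge1Dx (- a); rewrite expRN => h.
  have e0 := expR_gt0 a.
  have : (1 - a) * expR a <= 1 by rewrite -ler_pdivlMr// div1r.
  by rewrite mulrBl mul1r; lra.
have h2 := expR_ge1Dx a.
rewrite ger0_norm; last by lra.
have : expR a - 1 - a <= a * (expR a - 1) by rewrite mulrBr mulr1; lra.
move=> /le_trans; apply; rewrite (le_trans (ler_norm _))// normrM expr2 -mulrA.
have e1 : `|expR a - 1| <= `|a| * expR `|a|.
  have [a0|a0] := leP 0 a.
    by rewrite (ger0_norm a0) ger0_norm//; lra.
  rewrite ltr0_norm ?subr_lt0 ?expR_lt1// (ltr0_norm a0).
  apply: (@le_trans _ _ (- a)); first by lra.
  by rewrite ler_peMr -?expR0 ?ler_expR ?oppr_ge0 ?(ltW a0).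
rewrite -[leRHS]ger0_norm; last first.
  by rewrite mulrA -expr2 mulr_ge0 ?sqr_ge0 ?expR_ge0.
by rewrite !normrM ler_wpM2l// (le_trans e1)// (ger0_norm (expR_ge0 _)).
Qed.

Lemma expR_lipschitz (R : realType) (a b M : R) : a <= M -> b <= M ->
  `|expR a - expR b| <= expR M * `|a - b|.
Proof.
wlog ba : a b / b <= a => [H aM bM|aM bM].
  have [ba|/ltW ab] := leP b a; first exact: H.
  by rewrite distrC (distrC a); exact: H.
rewrite !ger0_norm ?subr_ge0 ?ler_expR//.
apply: (@le_trans _ _ (expR a * (a - b))); last first.
  by rewrite ler_wpM2r ?subr_ge0 ?ler_expR.
have := expR_ge1Dx (b - a).
rewrite expRB addrC ler_pdivlMr ?expR_gt0// => h.
have -> : expR a * (a - b) = expR a - (b - a + 1) * expR a by ring.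
by rewrite lerB.
Qed.

Section stationary.
Context {R : realType} {dE dO : measure_display}.
Context {E : measurableType dE} {Omega : measurableType dO}.
Variables (X : R -> Omega -> E) (Px : R.-pker E ~> Omega).
Hypothesis hX : is_markov_process X Px.
Variable mu : probability E R.
Hypothesis hinv : invariant_measure X Px mu.
Local Notation Pmu := (init_law Px mu).
Local Notation P_ := (semigroup X Px).

(** L^1 estimates under the law of the path descend to the conditional means given
the starting point. Estimates on Feynman-Kac functionals are obtained
in this way from estimates on paths. *)
Lemma mean_kernel_abs (nu : probability E R) (f : Omega -> R) : bmeas f ->
  \int[nu]_x `|\int[Px x]_w f w| <= \int[init_law Px nu]_w `|f w|.
Proof.
move=> bf; have bn := bmeas_norm bf.
rewrite init_law_mean//; apply: mean_le => //.
- by apply: bmeas_norm; exact: bmeas_kernel.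
- exact: bmeas_kernel.
- by move=> x; exact: mean_norm.
Qed.

Lemma stationary_mean s (f : E -> R) : 0 <= s -> bmeas f ->
  \int[Pmu]_w f (X s w) = \int[mu]_x f x.
Proof.
move=> s0 bf; have ms := measurable_path hX s0.
have b1 := bop_comp (bop_precomp ms) (bop_mean (prob_measT Pmu)).
apply: (bop_eq b1 (bop_mean (prob_measT mu)) _ bf tt) => B _ mB /=.
have -> : (fun w => \1_B (X s w)) = (\1_(X s @^-1` B) : Omega -> R) by [].
rewrite !mean_indic//; last by rewrite -[X in measurable X]setTI; exact: ms.
by congr fine; exact: hinv.
Qed.

Lemma semigroup_mean t (f : E -> R) : 0 <= t -> bmeas f ->
  \int[mu]_x P_ t f x = \int[mu]_x f x.
Proof.
move=> t0 bf; rewrite -(stationary_mean t0 bf) init_law_mean//.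
exact: (bmeas_path hX).
Qed.

Lemma semigroup_abs_mean t (f : E -> R) : 0 <= t -> bmeas f ->
  \int[mu]_x `|P_ t f x| <= \int[mu]_x `|f x|.
Proof.
move=> t0 bf; rewrite -(semigroup_mean t0 (bmeas_norm bf)).
have bp : bmeas (fun x => P_ t f x) by exact: (bmeas_semigroup hX).
apply: mean_le => //.
- exact: bmeas_norm.
- by apply: (bmeas_semigroup hX) => //; exact: bmeas_norm.
- by move=> x; apply: mean_norm => //; exact: (bmeas_path hX t0 bf).
Qed.

Lemma two_time_mean s t (f g : E -> R) : 0 <= s -> 0 <= t -> bmeas f -> bmeas g ->
  \int[Pmu]_w (f (X s w) * g (X (s + t) w)) = \int[mu]_x (f x * P_ t g x).
Proof.
move=> s0 t0 bf bg.
have bP := bmeas_semigroup hX t0 bg.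
have bfs := bmeas_path hX s0 bf.
rewrite init_law_mean; last by apply: bmeasM => //; apply: (bmeas_path hX) => //; exact: addr_ge0.
have ss : 0 <= s <= s by rewrite s0 lexx.
under eq_Rintegral.
  move=> x _; rewrite (markov_mean hX x s0 t0 (bmeas_past_path X ss bf) bg).
  over.
rewrite /= -init_law_mean; last by apply: bmeasM => //; exact: (bmeas_path hX s0 bP).
by rewrite (stationary_mean s0 (bmeasM bf bP)).
Qed.

Lemma bmeas_Lfun2 (f : E -> R) : bmeas f -> f \in Lfun mu 2%:E.
Proof.
move=> bf; rewrite inE/=; apply/andP; split; rewrite inE/=; first exact: bf.1.
have [C C0 fC] := bmeas_pos bf.
rewrite /finite_norm (@le_lt_trans _ _ C%:E) ?ltry//.
rewrite Lnorm2_le ?(ltW C0)// bmeas_EFin//; last exact: bmeasX.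
rewrite lee_fin; apply: mean_ub => //; first exact: bmeasX.
by move=> x; rewrite -real_normK ?num_real// lerXn2r// nnegrE ltW.
Qed.

Hypothesis hcont : strongly_continuous X Px mu.

(** L^1 is enough from here on, because all functions are bounded. *)
Lemma semigroup_L1_continuous (f : E -> R) : bmeas f -> forall e : R, 0 < e ->
  exists2 h0 : R, 0 < h0 & forall h : R, 0 < h -> h <= h0 ->
    \int[mu]_x `|P_ h f x - f x| <= e.
Proof.
move=> bf e e0; have bd h : 0 <= h -> bmeas (fun x => P_ h f x - f x).
  by move=> h0; apply: bmeasB => //; exact: (bmeas_semigroup hX).
have [|h0 h00 H] := @Lnorm2_cvg0_abs_mean _ _ _ mu (fun h x => P_ h f x - f x) _
  (hcont (bmeas_Lfun2 bf)) e e0.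
  by move=> h hp; apply: (bd h _).1; exact: ltW.
exists h0 => // h h1 h2; have := H h h1 h2.
by rewrite bmeas_EFin//; apply: bmeas_norm; apply: bd; exact: ltW.
Qed.

(** Under the stationary law, the mean square of U(X_{s+r}) - U(X_s) equals
2 <U, U - P_r U>, whatever s is, and strong continuity makes it small with r.
This replaces any regularity of the paths. *)
Lemma path_L1_continuous (U : E -> R) : bmeas U -> forall e : R, 0 < e ->
  exists2 h0 : R, 0 < h0 & forall s r : R, 0 <= s -> 0 <= r -> r <= h0 ->
    \int[Pmu]_w `|U (X (s + r) w) - U (X s w)| <= e.
Proof.
move=> bU e e0; have [C C0 UC] := bmeas_pos bU.
have [|h0 h00 H] := @semigroup_L1_continuous U bU (e ^+ 2 / (2 * C)).
  by rewrite divr_gt0 ?exprn_gt0// mulr_gt0.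
exists h0 => // s r s0; rewrite le_eqVlt => /predU1P[<- _|r0 rh].
  under eq_Rintegral do rewrite addr0 subrr normr0.
  by rewrite mean_cst ?(ltW e0).
have sr : 0 <= s + r by rewrite addr_ge0// ltW.
have ba := bmeas_path hX sr bU; have bb := bmeas_path hX s0 bU.
have bd := bmeasB ba bb.
have bU2 := bmeasX 2 bU.
have bP := bmeas_semigroup hX (ltW r0) bU.
rewrite -lee_fin -bmeas_EFin//; last exact: bmeas_norm.
apply: abs_mean_le => //; first exact: bd.1.
rewrite bmeas_EFin//; last exact: bmeasX.
rewrite lee_fin.
(* Expand the square; both squares have mean int U^2 dmu by stationarity. *)
have -> : \int[Pmu]_w (U (X (s + r) w) - U (X s w)) ^+ 2 =
    2 * \int[mu]_x (U x * (U x - P_ r U x)).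
  transitivity (\int[Pmu]_w ((U (X (s + r) w) ^+ 2 + U (X s w) ^+ 2) -
      2 * (U (X s w) * U (X (s + r) w)))).
    by apply: eq_Rintegral => w _; ring.
  rewrite meanB//; last 2 first.
  - by apply: bmeasD; exact: bmeasX.
  - by apply: bmeasM; [exact: bmeas_cst|exact: bmeasM].
  rewrite meanD//; [|exact: bmeasX..].
  rewrite meanZ//; last exact: bmeasM.
  rewrite two_time_mean ?(ltW r0)//.
  rewrite (stationary_mean sr bU2) (stationary_mean s0 bU2).
  under [in RHS]eq_Rintegral do rewrite mulrBr -expr2.
  by rewrite meanB//; [ring|exact: bmeasM].
apply: (@le_trans _ _ (2 * \int[mu]_x (C * `|P_ r U x - U x|))).
  rewrite ler_pM2l//; apply: mean_le => //.
  - by apply: bmeasM => //; exact: bmeasB.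
  - apply: bmeasM; first exact: bmeas_cst.
    by apply: bmeas_norm; exact: bmeasB.
  - by move=> x; rewrite (le_trans (ler_norm _))// normrM distrC ler_wpM2r.
rewrite meanZ//; last by apply: bmeas_norm; exact: bmeasB.
by rewrite mulrA mulrC -ler_pdivlMr ?mulr_gt0//; exact: H.
Qed.

End stationary.

(** * The Feynman-Kac functional and the generator *)

Section feynman_kac.
Context {R : realType} {dE dO : measure_display}.
Context {E : measurableType dE} {Omega : measurableType dO}.
Variables (X : R -> Omega -> E) (Px : R.-pker E ~> Omega).
Hypothesis hX : is_markov_process X Px.
Variable mu : probability E R.
Hypothesis hinv : invariant_measure X Px mu.
Hypothesis hcont : strongly_continuous X Px mu.
Local Notation Pmu := (init_law Px mu).
Local Notation P_ := (semigroup X Px).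
Variables (U : E -> R) (C : R).
Hypotheses (bU : bmeas U) (C0 : 0 < C) (UC : forall x, `|U x| <= C).

(** Frozen at negative times for the sake of joint measurability. *)
Definition potential (r : R) (w : Omega) : R := U (X (Num.max r 0) w).
Local Notation y := potential.
Local Notation S a b := (fun w => expR (tint y a b w)).

Lemma potentialE r w : 0 <= r -> y r w = U (X r w).
Proof. by move=> r0; rewrite /y (max_idPl r0). Qed.

Lemma potential_bound r w : `|y r w| <= C.
Proof. exact: UC. Qed.

Lemma potential_jointly : jointly_bmeas y.
Proof. exact: (bmeas_comp (measurable_positive_path hX) bU). Qed.
Let jy := potential_jointly.

Lemma bmeas_potential r : bmeas (y r).
Proof. exact: jointly_bmeas_at jy. Qed.
Let by_ := bmeas_potential.

Lemma potential_tint_bound a b w : a <= b -> `|tint y a b w| <= C * (b - a).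
Proof. by move=> ab; exact: (tint_bound w jy ab potential_bound). Qed.

Lemma bmeas_S a b : a <= b -> bmeas (S a b).
Proof. by move=> ab; apply: bmeas_exp; exact: bmeas_tint. Qed.

Lemma S_bound a b w : a <= b -> `|expR (tint y a b w)| <= expR (C * (b - a)).
Proof.
move=> ab; rewrite ger0_norm ?expR_ge0// ler_expR.
exact: le_trans (ler_norm _) (potential_tint_bound w ab).
Qed.

Lemma tint_increment (e : R) : 0 < e -> exists2 h0 : R, 0 < h0 &
  forall s h : R, 0 <= s -> 0 <= h -> h <= h0 ->
  \int[Pmu]_w `|tint y s (s + h) w - h * y s w| <= e * h.
Proof.
move=> e0; have [h0 h00 H] := path_L1_continuous hX hinv hcont bU e0.
exists h0 => // s h s0 h1 h2.
have sh : s <= s + h by rewrite lerDl.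
have hE : h = s + h - s by rewrite addrC addKr.
rewrite {2 3}hE; apply: mean_abs_tintB_le => //.
move=> r /andP[sr rsh]; have r0 := le_trans s0 sr.
under eq_Rintegral do rewrite !potentialE//.
have -> : r = s + (r - s) by rewrite addrC subrK.
by apply: H => //; rewrite ?subr_ge0// lerBlDl (le_trans rsh)// lerD2l.
Qed.

(** First order expansion of the exponential of the integral over a short interval,
in mean and uniformly in the position of the interval. Both expansions of the
Feynman-Kac functional below, at the end and at the start of the time interval,
come from it. *)
Lemma exp_increment (e : R) : 0 < e -> exists2 h0 : R, 0 < h0 &
  forall s h : R, 0 <= s -> 0 <= h -> h <= h0 ->
  \int[Pmu]_w `|expR (tint y s (s + h) w) - 1 - h * y s w| <= e * h.
Proof.
move=> e0; have e2 : 0 < e / 2 by rewrite divr_gt0.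
have [h0 h00 H] := tint_increment e2.
(* The second order term is at most K h^2, since |int U| <= C h and h <= 1. *)
pose K := C ^+ 2 * expR C.
have K0 : 0 < K by rewrite mulr_gt0 ?exprn_gt0 ?expR_gt0.
exists (Num.min h0 (Num.min 1 (e / (2 * K)))).
  by rewrite !lt_min h00 ltr01 divr_gt0// mulr_gt0.
move=> s h s0 h1; rewrite !le_min => /and3P[hh0 hh1 hhK].
have sh : s <= s + h by rewrite lerDl.
have ba := bmeas_tint jy sh.
have bh : bmeas (fun w => h * y s w) by apply: bmeasM => //; exact: bmeas_cst.
apply: (@le_trans _ _ (\int[Pmu]_w (`|tint y s (s + h) w - h * y s w| + K * h ^+ 2))).
  apply: mean_le => //.
  - apply: bmeas_norm; apply: bmeasB => //; apply: bmeasB; last exact: bmeas_cst.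
    exact: bmeas_exp.
  - by apply: bmeasD; [apply: bmeas_norm; exact: bmeasB|exact: bmeas_cst].
  - move=> w; set a := tint _ _ _ _; set b := h * _.
    have -> : expR a - 1 - b = (a - b) + (expR a - 1 - a) by ring.
    rewrite (le_trans (ler_normD _ _))// lerD2l (le_trans (expR_taylor1 _))//.
    have aC : `|a| <= C * h.
      by have := potential_tint_bound w sh; have -> : s + h - s = h by ring.
    have -> : K * h ^+ 2 = (C * h) ^+ 2 * expR C by rewrite /K; ring.
    rewrite ler_pM ?sqr_ge0 ?expR_ge0//.
      by rewrite -(real_normK (num_real a)) lerXn2r ?nnegrE ?mulr_ge0 ?(ltW C0).
    by rewrite ler_expR (le_trans aC)// ler_piMr// ltW.
rewrite meanD//; [|by apply: bmeas_norm; exact: bmeasB|exact: bmeas_cst].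
rewrite mean_cst//.
have -> : e * h = e / 2 * h + e / 2 * h by field.
apply: lerD; first exact: H.
rewrite expr2 mulrA ler_wpM2r//.
by rewrite mulrC -ler_pdivlMr// -mulrA -invfM.
Qed.

(** The error on each cell is small with respect to its length by
[tint_increment], so the errors add up to a small multiple of t. The number of
cells does not depend on s: this uniformity is what [fk_path_markov] uses, for
s = 0 and s = h. *)
Lemma riemann_sum (t e : R) : 0 <= t -> 0 < e -> exists n : nat,
  forall s : R, 0 <= s ->
  \int[Pmu]_w `|tint y s (s + t) w -
     \sum_(i < n.+1) (t / n.+1%:R) * y (s + i%:R * (t / n.+1%:R)) w| <= e.
Proof.
move=> t0 e0; have t1 : 0 < t + 1 by rewrite ltr_wpDl.
have e1 : 0 < e / (t + 1) by rewrite divr_gt0.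
have [h0 h00 H] := tint_increment e1.
have [n nP] : exists n : nat, t / n.+1%:R <= h0.
  exists (Num.truncn (t / h0)).
  rewrite ler_pdivrMr// mulrC -ler_pdivrMr// ltW//.
  by rewrite truncnS_gt.
exists n => s s0; set d := t / _; have d0 : 0 <= d by rewrite divr_ge0.
have tE : t = n.+1%:R * d by rewrite /d mulrC divfK// pnatr_eq0.
rewrite [in X in tint y s X]tE.
suff K k : \int[Pmu]_w `|tint y s (s + k%:R * d) w -
    \sum_(i < k) d * y (s + i%:R * d) w| <= e / (t + 1) * (k%:R * d).
  rewrite (le_trans (K _))// -tE mulrAC ler_pdivrMr// ler_pM2l// lerDl//.
elim: k => [|k IH].
  under eq_Rintegral.
    move=> w _; rewrite big_ord0 mul0r addr0 subr0.
    have -> : tint y s s w = 0.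
      apply/eqP; rewrite -normr_eq0 eq_le normr_ge0 andbT.
      by rewrite (le_trans (potential_tint_bound w (lexx s)))// subrr mulr0.
    rewrite normr0; over.
  by rewrite mean_cst// !mul0r mulr0.
have kd0 : 0 <= k%:R * d by rewrite mulr_ge0.
have l1 : s <= s + k%:R * d by rewrite lerDl.
have l2 : s + k%:R * d <= s + k.+1%:R * d by rewrite lerD2l ler_wpM2r// ler_nat.
have l3 : s + k.+1%:R * d = (s + k%:R * d) + d by rewrite -addrA -natr1 mulrDl mul1r.
have bs j : bmeas (fun w => \sum_(i < j) d * y (s + i%:R * d) w).
  elim: j => [|j IHj]; first by under eq_fun do rewrite big_ord0; exact: bmeas_cst.
  under eq_fun do rewrite big_ord_recr/=.
  by apply: bmeasD => //; apply: bmeasM => //; exact: bmeas_cst.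
have b1 : bmeas (fun w => tint y s (s + k%:R * d) w - \sum_(i < k) d * y (s + i%:R * d) w).
  by apply: bmeasB => //; exact: bmeas_tint.
have b2 : bmeas (fun w => tint y (s + k%:R * d) (s + k%:R * d + d) w -
     d * y (s + k%:R * d) w).
  apply: bmeasB; first by apply: bmeas_tint => //; rewrite lerDl.
  by apply: bmeasM => //; exact: bmeas_cst.
apply: (@le_trans _ _ (\int[Pmu]_w (`|tint y s (s + k%:R * d) w -
    \sum_(i < k) d * y (s + i%:R * d) w| +
   `|tint y (s + k%:R * d) (s + k%:R * d + d) w - d * y (s + k%:R * d) w|))).
  apply: mean_le => //.
  - by apply: bmeas_norm; apply: bmeasB => //; apply: bmeas_tint => //; exact: le_trans l2.
  - by apply: bmeasD; exact: bmeas_norm.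
  - move=> w; rewrite (tint_split w jy l1 l2) big_ord_recr/= l3.
    rewrite opprD addrACA; exact: ler_normD.
rewrite meanD//; [|exact: bmeas_norm..].
rewrite -natr1 !mulrDl mul1r mulrDr; apply: lerD => //.
by apply: H; rewrite ?addr_ge0.
Qed.

(** The exponential of a Riemann sum is a product over a time grid, the kind of
functional to which [discrete_shift] applies. *)
Lemma exp_riemann (t e : R) : 0 <= t -> 0 < e -> exists n : nat,
  forall s : R, 0 <= s ->
  \int[Pmu]_w `|expR (tint y s (s + t) w) -
     \prod_(i < n.+1) expR (t / n.+1%:R * U (X (s + i%:R * (t / n.+1%:R)) w))| <= e.
Proof.
move=> t0 e0; have eC : 0 < e / expR (C * t) by rewrite divr_gt0 ?expR_gt0.
have [n H] := riemann_sum t0 eC; exists n => s s0.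
set d := t / _; have d0 : 0 <= d by rewrite divr_ge0.
have st : s <= s + t by rewrite lerDl.
pose Z w := \sum_(i < n.+1) d * y (s + i%:R * d) w.
have prodE w : \prod_(i < n.+1) expR (d * U (X (s + i%:R * d) w)) = expR (Z w).
  rewrite (big_morph expR (@expRD R) (@expR0 R)); apply: eq_bigr => i _.
  by rewrite potentialE// addr_ge0// mulr_ge0.
under eq_Rintegral do rewrite prodE.
have bZ : bmeas Z.
  rewrite /Z; elim: n.+1 => [|j IHj]; first by under eq_fun do rewrite big_ord0; exact: bmeas_cst.
  under eq_fun do rewrite big_ord_recr/=.
  by apply: bmeasD => //; apply: bmeasM => //; exact: bmeas_cst.
have bT := bmeas_tint jy st.
have bTZ := bmeas_norm (bmeasB bT bZ).
apply: (@le_trans _ _ (\int[Pmu]_w (expR (C * t) * `|tint y s (s + t) w - Z w|))).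
  apply: mean_le => //.
  - by apply: bmeas_norm; apply: bmeasB; exact: bmeas_exp.
  - by apply: bmeasM => //; exact: bmeas_cst.
  - move=> w; apply: expR_lipschitz.
      rewrite (le_trans (ler_norm _))//.
      by have := potential_tint_bound w st; have -> : s + t - s = t by ring.
    apply: (@le_trans _ _ (\sum_(i < n.+1) d * C)).
      apply: ler_sum => i _; rewrite ler_wpM2l//.
      exact: le_trans (ler_norm _) (potential_bound _ _).
    rewrite sumr_const card_ord -mulr_natl /d.
    by rewrite mulrA mulrCA divff ?mulr1 ?pnatr_eq0// mulrC.
by rewrite meanZ// mulrC -ler_pdivlMr ?expR_gt0//; exact: H.
Qed.

(** fk t is the Feynman-Kac semigroup applied to 1, fkU t the same semigroup applied
to U, that is, the time derivative of fk. *)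
Definition fk (t : R) (x : E) : R := \int[Px x]_w expR (tint y 0 t w).
Definition fkU (t : R) (x : E) : R := \int[Px x]_w (expR (tint y 0 t w) * y t w).

Lemma bmeas_fk t : 0 <= t -> bmeas (fk t).
Proof. by move=> t0; apply: bmeas_kernel; exact: bmeas_S. Qed.

Lemma bmeas_fkU t : 0 <= t -> bmeas (fkU t).
Proof. by move=> t0; apply: bmeas_kernel; apply: bmeasM => //; exact: bmeas_S. Qed.

Lemma fk_bound t x : 0 <= t -> `|fk t x| <= expR (C * t).
Proof.
move=> t0; apply: mean_bound => //; first exact: bmeas_S.
by move=> w; have := S_bound w t0; rewrite subr0.
Qed.

Lemma fkU_bound t x : 0 <= t -> `|fkU t x| <= expR (C * t) * C.
Proof.
move=> t0; apply: mean_bound => //; first by apply: bmeasM => //; exact: bmeas_S.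
move=> w; rewrite normrM ler_pM// ?potential_bound//.
by have := S_bound w t0; rewrite subr0.
Qed.

(** A version of P_h (fk t) that is written as one expectation over paths, see
[fk_path_markov]. The integrand factors at time h, and closeness to fk t is clear
at every point. *)
Definition fk_shifted (h t : R) (x : E) : R := \int[Px x]_w expR (tint y h (h + t) w).

Lemma bmeas_fk_shifted h t : 0 <= t -> bmeas (fk_shifted h t).
Proof. by move=> t0; apply: bmeas_kernel; apply: bmeas_S; rewrite lerDl. Qed.

(** Path-level Markov property for the Feynman-Kac functional, up to a mu-null set.
Replace the exponential by products over a grid on both sides, with an L^1
error which is arbitrarily small; for products the identity is
[discrete_shift]. Only almost everywhere equality can result, since the
approximation holds in mean under the stationary law. *)
Lemma fk_path_markov h t : 0 <= h -> 0 <= t ->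
  \int[mu]_x `|P_ h (fk t) x - fk_shifted h t x| = 0.
Proof.
move=> h0 t0; apply/eqP; rewrite eq_le mean_ge0// andbT.
apply/ler_addgt0Pr => e e0; rewrite add0r.
have e2 : 0 < e / 2 by rewrite divr_gt0.
have [n H] := exp_riemann t0 e2.
set d := t / n.+1%:R in H; have d0 : 0 <= d by rewrite divr_ge0.
pose g x := expR (d * U x).
have bg : bmeas g by apply: bmeas_exp; apply: bmeasM => //; exact: bmeas_cst.
pose G s w := \prod_(i < n.+1) g (X (s + i%:R * d) w).
have bG s : 0 <= s -> bmeas (G s).
  move=> s0; apply: (@bmeas_prod _ _ _ n.+1 (fun i w => g (X (s + i%:R * d) w))) => i.
  by apply: (bmeas_path hX) => //; rewrite addr_ge0// mulr_ge0.
pose fn x := \int[Px x]_w G 0 w.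
have bfn : bmeas fn by apply: bmeas_kernel; exact: bG.
have bfk := bmeas_fk t0.
have bD : bmeas (fun x => fk t x - fn x) by exact: bmeasB.
have bS0 := bmeas_S t0.
have ht : h <= h + t by rewrite lerDl.
have bSh := bmeas_S ht.
have bK : bmeas (fun x => \int[Px x]_w (G h w - expR (tint y h (h + t) w))).
  by apply: bmeas_kernel; apply: bmeasB => //; exact: bG.
have E1 x : P_ h (fk t) x - fk_shifted h t x =
    P_ h (fun x => fk t x - fn x) x + \int[Px x]_w (G h w - expR (tint y h (h + t) w)).
  rewrite meanB//; last exact: bG.
  rewrite /G (discrete_shift hX bg d0 n.+1 x h0).
  have -> : (fun y => \int[Px y]_w \prod_(i < n.+1) g (X (i%:R * d) w)) = fn.
    apply/funext => x'; apply: eq_Rintegral => w _.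
    by apply: eq_bigr => i _; rewrite add0r.
  rewrite /semigroup meanB//; [|exact: (bmeas_path hX h0 bfk)|exact: (bmeas_path hX h0 bfn)].
  by rewrite /fk_shifted addrA subrK.
under eq_Rintegral do rewrite E1.
have bP := bmeas_semigroup hX h0 bD.
apply: (@le_trans _ _ (\int[mu]_x (`|P_ h (fun x => fk t x - fn x) x| +
   `|\int[Px x]_w (G h w - expR (tint y h (h + t) w))|))).
  apply: mean_le => //; [by apply: bmeas_norm; exact: bmeasD| |by move=> x; exact: ler_normD].
  by apply: bmeasD; exact: bmeas_norm.
rewrite meanD//; [|exact: bmeas_norm..].
have -> : e = e / 2 + e / 2 by field.
apply: lerD.
  apply: (le_trans (semigroup_abs_mean hX hinv h0 bD)).
  have bG0 := bG 0 (lexx 0).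
  have bSG : bmeas (fun w => expR (tint y 0 t w) - G 0 w) by exact: bmeasB bS0 bG0.
  have := H 0 (lexx 0); under eq_Rintegral do rewrite add0r; apply: le_trans.
  apply: le_trans (mean_kernel_abs Px mu bSG).
  apply: mean_le => //; first exact: bmeas_norm.
    by apply: bmeas_norm; exact: bmeas_kernel.
  by move=> x; rewrite (meanB (prob_kernel x) bS0 bG0).
apply: (le_trans (mean_kernel_abs Px mu (bmeasB (bG h h0) bSh))).
by under eq_Rintegral do rewrite distrC; exact: H.
Qed.

(** Split [0, t + h] at t and expand the factor over the last interval. *)
Lemma fk_increment (e : R) : 0 < e -> exists2 h0 : R, 0 < h0 &
  forall t h : R, 0 <= t -> 0 <= h -> h <= h0 ->
  \int[mu]_x `|fk (t + h) x - fk t x - h * fkU t x| <= expR (C * t) * (e * h).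
Proof.
move=> e0; have [h0 h00 H] := exp_increment e0.
exists h0 => // t h t0 h1 h2.
have th : t <= t + h by rewrite lerDl.
have th0 : 0 <= t + h by exact: le_trans th.
have bSt := bmeas_S t0; have bSth := bmeas_S th0; have bSi := bmeas_S th.
have byt := by_ t.
have bI : bmeas (fun w => expR (tint y t (t + h) w) - 1 - h * y t w).
  exact: (bmeasB (bmeasB bSi (bmeas_cst 1)) (bmeasM (bmeas_cst h) byt)).
have bZ := bmeasM bSt bI.
have E1 x : fk (t + h) x - fk t x - h * fkU t x =
    \int[Px x]_w (expR (tint y 0 t w) * (expR (tint y t (t + h) w) - 1 - h * y t w)).
  transitivity (\int[Px x]_w (expR (tint y 0 (t + h) w) - expR (tint y 0 t w) -
      h * (expR (tint y 0 t w) * y t w))).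
    rewrite (meanB (prob_kernel x) (bmeasB bSth bSt)
      (bmeasM (bmeas_cst h) (bmeasM bSt byt))).
    by rewrite (meanB (prob_kernel x) bSth bSt) (meanZ (prob_kernel x) _ (bmeasM bSt byt)).
  apply: eq_Rintegral => w _; rewrite (tint_split w jy t0 th) expRD.
  by move: (expR _) (expR _) (y t w) => u v z; ring.
under eq_Rintegral do rewrite E1.
apply: (le_trans (mean_kernel_abs Px mu bZ)).
apply: (@le_trans _ _ (\int[Pmu]_w (expR (C * t) *
    `|expR (tint y t (t + h) w) - 1 - h * y t w|))).
  apply: (mean_le (init_law_mass Px mu) (bmeas_norm bZ)
    (bmeasM (bmeas_cst (expR (C * t))) (bmeas_norm bI))).
  move=> w; rewrite normrM ler_wpM2r//.
  by have := S_bound w t0; rewrite subr0.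
rewrite (meanZ (init_law_mass Px mu) _ (bmeas_norm bI)).
by rewrite ler_wpM2l ?expR_ge0//; exact: H.
Qed.

(** Split [0, t + h] at h and expand the factor over the first interval, where the
potential is close to U(x). Comparison with [fk_increment], which expands the
same fk (t + h) from the other end, gives P_h (fk t) - fk t to first order. *)
Lemma fk_shifted_increment (t e : R) : 0 <= t -> 0 < e -> exists2 h0 : R, 0 < h0 &
  forall h : R, 0 <= h -> h <= h0 ->
  \int[mu]_x `|fk (t + h) x - fk_shifted h t x - h * (U x * fk_shifted h t x)|
    <= expR (C * t) * (e * h).
Proof.
move=> t0 e0; have [h0 h00 H] := exp_increment e0.
exists h0 => // h h1 h2.
have ht : h <= h + t by rewrite lerDl.
have ht0 : 0 <= h + t by exact: le_trans ht.
have bSh := bmeas_S h1; have bSht := bmeas_S ht0; have bSi := bmeas_S ht.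
have bU0 : bmeas (fun w => U (X 0 w)) by exact: (bmeas_path hX (lexx 0) bU).
have bI : bmeas (fun w => expR (tint y 0 h w) - 1 - h * U (X 0 w)).
  exact: (bmeasB (bmeasB bSh (bmeas_cst 1)) (bmeasM (bmeas_cst h) bU0)).
have bZ := bmeasM bSi bI.
have E1 x : fk (t + h) x - fk_shifted h t x - h * (U x * fk_shifted h t x) =
    \int[Px x]_w (expR (tint y h (h + t) w) * (expR (tint y 0 h w) - 1 - h * U (X 0 w))).
  rewrite (addrC t) -(start_mean hX x bU bSi).
  transitivity (\int[Px x]_w (expR (tint y 0 (h + t) w) - expR (tint y h (h + t) w) -
      h * (U (X 0 w) * expR (tint y h (h + t) w)))).
    rewrite (meanB (prob_kernel x) (bmeasB bSht bSi)
      (bmeasM (bmeas_cst h) (bmeasM bU0 bSi))).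
    by rewrite (meanB (prob_kernel x) bSht bSi) (meanZ (prob_kernel x) _ (bmeasM bU0 bSi)).
  apply: eq_Rintegral => w _; rewrite (tint_split w jy h1 ht) expRD.
  by move: (expR _) (expR _) (U _) => u v z; ring.
under eq_Rintegral do rewrite E1.
apply: (le_trans (mean_kernel_abs Px mu bZ)).
apply: (@le_trans _ _ (\int[Pmu]_w (expR (C * t) *
    `|expR (tint y 0 h w) - 1 - h * U (X 0 w)|))).
  apply: (mean_le (init_law_mass Px mu) (bmeas_norm bZ)
    (bmeasM (bmeas_cst (expR (C * t))) (bmeas_norm bI))).
  move=> w; rewrite normrM ler_wpM2r//.
  by have := S_bound w ht; have -> : h + t - h = t by ring.
rewrite (meanZ (init_law_mass Px mu) _ (bmeas_norm bI)).
rewrite ler_wpM2l ?expR_ge0//.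
have := H 0 h (lexx 0) h1 h2; rewrite add0r.
by under eq_Rintegral do rewrite potentialE//.
Qed.

(** Pointwise and crude estimates; they serve to keep the difference quotients
bounded. *)
Lemma exp_tint_near a b a' b' w M : a <= b -> a' <= b' ->
  b - a <= M -> b' - a' <= M ->
  `|expR (tint y a b w) - expR (tint y a' b' w)| <=
    expR (C * M) * `|tint y a b w - tint y a' b' w|.
Proof.
move=> ab ab' bM bM'; apply: expR_lipschitz; rewrite (le_trans (ler_norm _))//.
- by rewrite (le_trans (potential_tint_bound w ab))// ler_wpM2l// ltW.
- by rewrite (le_trans (potential_tint_bound w ab'))// ler_wpM2l// ltW.
Qed.

Lemma fk_near t h x : 0 <= t -> 0 <= h -> h <= 1 ->
  `|fk (t + h) x - fk t x| <= C * expR (C * (t + 1)) * h.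
Proof.
move=> t0 h0 h1; have th : t <= t + h by rewrite lerDl.
have th0 : 0 <= t + h by rewrite addr_ge0.
rewrite /fk -(meanB (prob_kernel x) (bmeas_S th0) (bmeas_S t0)).
apply: (mean_bound (prob_kernel x) (bmeasB (bmeas_S th0) (bmeas_S t0))) => w.
rewrite (le_trans (@exp_tint_near _ _ _ _ w (t + 1) th0 t0 _ _))// ?subr0 ?lerD2l// ?lerDl//.
rewrite (tint_split w jy t0 th) [X in `|X|]addrC addKr.
rewrite [leLHS]mulrC [leRHS]mulrAC ler_wpM2r ?expR_ge0//.
by have := potential_tint_bound w th; rewrite [t + h]addrC addrK.
Qed.

Lemma fk_shifted_near t h x : 0 <= t -> 0 <= h -> h <= 1 ->
  `|fk_shifted h t x - fk t x| <= 2 * (C * expR (C * (t + 1)) * h).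
Proof.
move=> t0 h0 h1; have ht : h <= h + t by rewrite lerDl.
have ht0 : 0 <= h + t by rewrite addr_ge0.
have e1 : h + t - 0 <= t + 1 by rewrite subr0 addrC lerD2l.
have e2 : h + t - h <= t + 1 by rewrite addrC addKr lerDl.
have n2 : `|fk (h + t) x - fk_shifted h t x| <= C * expR (C * (t + 1)) * h.
  rewrite -(meanB (prob_kernel x) (bmeas_S ht0) (bmeas_S ht)).
  apply: (mean_bound (prob_kernel x) (bmeasB (bmeas_S ht0) (bmeas_S ht))) => w.
  rewrite (le_trans (@exp_tint_near _ _ _ _ w (t + 1) ht0 ht e1 e2))//.
  rewrite (tint_split w jy h0 ht) addrK.
  rewrite [leLHS]mulrC [leRHS]mulrAC ler_wpM2r ?expR_ge0//.
  by have := potential_tint_bound w h0; rewrite subr0.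
have n1 := fk_near x t0 h0 h1; rewrite (addrC t h) in n1.
move: n1 n2; move: (fk (h + t) x) (fk_shifted h t x) (fk t x) => p q r n1 n2.
have -> : q - r = (p - r) - (p - q) by ring.
rewrite (le_trans (ler_normB _ _))//; move: (lerD n1 n2) => /le_trans; apply.
by rewrite [leRHS]mulr_natl mulr2n.
Qed.

(** L (fk t) = fkU t - U (fk t), the Feynman-Kac equation. To first order in h,
fk (t + h) = fk t + h fkU t by [fk_increment] and
fk (t + h) = P_h (fk t) + h U P_h (fk t) by [fk_shifted_increment];
subtract. The quotients are bounded, up to null sets, by [fk_shifted_near], so
that L^1 convergence gives the L^2 convergence in the definition of the
generator. *)
Lemma fk_generator t : 0 <= t ->
  is_generator X Px mu (fk t) (fun x => fkU t x - U x * fk t x).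
Proof.
move=> t0; have bF := bmeas_fk t0; have bFU := bmeas_fkU t0.
have bg : bmeas (fun x => fkU t x - U x * fk t x) by exact: (bmeasB bFU (bmeasM bU bF)).
split; [exact: bmeas_Lfun2|exact: bmeas_Lfun2|].
set g := (fun x => fkU t x - U x * fk t x) in bg *.
have [G G0 gG] := bmeas_pos bg.
pose M := C * expR (C * (t + 1)).
have M0 : 0 < M by rewrite mulr_gt0 ?expR_gt0.
have bP h : 0 < h -> bmeas (fun x => P_ h (fk t) x).
  by move=> hp; exact: (bmeas_semigroup hX (ltW hp) bF).
have bsh h := @bmeas_fk_shifted h t t0.
have bq h (f : E -> R) : bmeas f -> bmeas (fun x => h^-1 * (f x - fk t x) - g x).
  by move=> bf; exact: (bmeasB (bmeasM (bmeas_cst h^-1) (bmeasB bf bF)) bg).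
have K0 : 0 < 2 * M + G by rewrite addr_gt0// mulr_gt0.
(* The quotients of P_h (fk t) are known to be bounded only off a null set. *)
apply: (@bounded_Lnorm2_cvg0 _ _ _ mu
  (fun h x => h^-1 * (P_ h (fk t) x - fk t x) - g x)
  (fun h x => h^-1 * (fk_shifted h t x - fk t x) - g x) _ K0).
- by move=> h hp; exact: (bq h _ (bP h hp)).
- exists 1 => // h hp h1; split; first exact: (bq h _ (bsh h)).
    move=> x; rewrite (le_trans (ler_normB _ _))// lerD// normrM gtr0_norm ?invr_gt0//.
    rewrite mulrC ler_pdivrMr// (le_trans (fk_shifted_near _ t0 (ltW hp) h1))//.
    by rewrite mulrA.
  transitivity (\int[mu]_x (h^-1 * `|P_ h (fk t) x - fk_shifted h t x|)).
    apply: eq_Rintegral => x _.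
    have hN : h^-1 = `|h^-1| by rewrite gtr0_norm ?invr_gt0.
    rewrite [in RHS]hN -normrM; congr (`| _ |).
    by move: (P_ h _ x) (fk t x) (fk_shifted h t x) (g x) => p q r z; ring.
  rewrite (meanZ (prob_measT mu) _ (bmeas_norm (bmeasB (bP h hp) (bsh h)))).
  by rewrite fk_path_markov ?mulr0// ltW.
- move=> e e0.
  pose A := expR (C * t); have A0 : 0 < A by exact: expR_gt0.
  have eA : 0 < e / (4 * A) by rewrite divr_gt0// mulr_gt0.
  have eC : 0 < e / (2 * C) by rewrite divr_gt0// mulr_gt0.
  have [h1 h10 H1] := fk_increment eA.
  have [h2 h20 H2] := fk_shifted_increment t0 eA.
  have [h3 h30 H3] := semigroup_L1_continuous hX hcont bF eC.
  exists (Num.min h1 (Num.min h2 h3)); first by rewrite !lt_min h10 h20.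
  move=> h hp; rewrite !le_min => /and3P[hh1 hh2 hh3]; have h0 := ltW hp.
  have th0 : 0 <= t + h by rewrite addr_ge0.
  have mean_comb (f1 f2 f3 f4 : E -> R) : bmeas f1 -> bmeas f2 -> bmeas f3 -> bmeas f4 ->
      \int[mu]_x (h^-1 * (f3 x + f1 x + f2 x) + C * (f4 x + f3 x)) =
      h^-1 * (\int[mu]_x f3 x + \int[mu]_x f1 x + \int[mu]_x f2 x) +
      C * (\int[mu]_x f4 x + \int[mu]_x f3 x).
    move=> n1 n2 n3 n4; have n31 := bmeasD n3 n1; have n312 := bmeasD n31 n2.
    have n43 := bmeasD n4 n3.
    rewrite (meanD (prob_measT mu) (bmeasM (bmeas_cst h^-1) n312) (bmeasM (bmeas_cst C) n43)).
    rewrite (meanZ (prob_measT mu) _ n312) (meanZ (prob_measT mu) _ n43).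
    by rewrite (meanD (prob_measT mu) n31 n2) (meanD (prob_measT mu) n3 n1)
      (meanD (prob_measT mu) n4 n3).
  pose a x := fk (t + h) x - fk t x - h * fkU t x.
  pose b x := fk (t + h) x - fk_shifted h t x - h * (U x * fk_shifted h t x).
  pose c x := P_ h (fk t) x - fk_shifted h t x.
  pose d x := P_ h (fk t) x - fk t x.
  have bFh := bmeas_fk th0.
  have ba : bmeas a by exact: (bmeasB (bmeasB bFh bF) (bmeasM (bmeas_cst h) bFU)).
  have bb : bmeas b.
    exact: (bmeasB (bmeasB bFh (bsh h)) (bmeasM (bmeas_cst h) (bmeasM bU (bsh h)))).
  have bc : bmeas c by exact: (bmeasB (bP h hp) (bsh h)).
  have bd : bmeas d by exact: (bmeasB (bP h hp) bF).
  have c0 : \int[mu]_x `|c x| = 0 by rewrite /c fk_path_markov// ltW.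
  have na := bmeas_norm ba; have nb := bmeas_norm bb.
  have nc := bmeas_norm bc; have nd := bmeas_norm bd.
  have nca := bmeasD nc na; have ncab := bmeasD nca nb.
  have bL := bmeasM (bmeas_cst h^-1) ncab.
  have ndc := bmeasD nd nc.
  have bR := bmeasM (bmeas_cst C) ndc.
  apply: (@le_trans _ _ (\int[mu]_x (h^-1 * (`|c x| + `|a x| + `|b x|) +
    C * (`|d x| + `|c x|)))).
    apply: (mean_le (prob_measT mu) (bmeas_norm (bq h _ (bP h hp))) (bmeasD bL bR)) => x.
    (* The choice of a, b, c, d makes fk (t + h) cancel. *)
    have -> : h^-1 * (P_ h (fk t) x - fk t x) - g x =
        h^-1 * (c x + a x - b x) - U x * (d x - c x).
      rewrite /g /a /b /c /d.
      move: (P_ h _ x) (fk_shifted h t x) (fk t x) (fk (t + h) x) (fkU t x) (U x).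
      by move=> p s f f' u v; field; rewrite gt_eqF.
    rewrite (le_trans (ler_normB _ _))// lerD// normrM.
      rewrite gtr0_norm ?invr_gt0// ler_wpM2l ?invr_ge0//.
      by rewrite (le_trans (ler_normB _ _))// lerD2r ler_normD.
    by rewrite ler_pM// ler_normB.
  have Ha : \int[mu]_x `|a x| <= A * (e / (4 * A) * h) := H1 t h t0 h0 hh1.
  have Hb : \int[mu]_x `|b x| <= A * (e / (4 * A) * h) := H2 h h0 hh2.
  have Hd : \int[mu]_x `|d x| <= e / (2 * C) := H3 h hp hh3.
  rewrite (mean_comb _ _ _ _ na nb nc nd).
  suff fin ia ib ic id : ic = 0 -> ia <= A * (e / (4 * A) * h) ->
      ib <= A * (e / (4 * A) * h) -> id <= e / (2 * C) ->
      h^-1 * (ic + ia + ib) + C * (id + ic) <= e by exact: (fin _ _ _ _ c0 Ha Hb Hd).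
  move=> -> ja jb jd; rewrite add0r addr0.
  have -> : e = h^-1 * (A * (e / (4 * A) * h) + A * (e / (4 * A) * h)) + C * (e / (2 * C)).
    by field; rewrite !gt_eqF.
  apply: lerD; last by rewrite ler_wpM2l ?(ltW C0).
  by rewrite ler_wpM2l ?invr_ge0//; exact: lerD.
Qed.
End feynman_kac.

(** * Growth of the second moment *)

(** An Euler scheme version of Gronwall's lemma: only a one-sided increment
inequality with an error o(h), uniform in time, is required, and no
differentiability. *)
Lemma discrete_gronwall (R : realType) (N : R -> R) (L T : R) : 0 <= L -> 0 < T ->
  N 0 <= 1 ->
  (forall eta : R, 0 < eta -> exists2 h0 : R, 0 < h0 & forall t h : R,
    0 <= t -> 0 <= h -> h <= h0 -> t + h <= T ->
    N (t + h) <= (1 + L * h) * N t + eta * h) ->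
  N T <= expR (L * T).
Proof.
move=> L0 T0 N0 H; apply/ler_addgt0Pr => e e0.
have eT : 0 < expR (L * T) * T by rewrite mulr_gt0 ?expR_gt0.
(* The accumulated error is at most exp(L T) eta T = e. *)
pose eta := e / (expR (L * T) * T); have eta0 : 0 < eta by rewrite divr_gt0.
have [h0 h00 Hh] := H eta eta0.
pose n := Num.truncn (T / h0); pose h := T / n.+1%:R.
have hp : 0 < h by rewrite divr_gt0.
have hh0 : h <= h0.
  by rewrite ler_pdivrMr// mulrC -ler_pdivrMr// ltW// truncnS_gt.
have TE : T = n.+1%:R * h by rewrite /h mulrC divfK// pnatr_eq0.
have Lh : 0 <= L * h by rewrite mulr_ge0// ltW.
suff K k : (k <= n.+1)%N -> N (k%:R * h) <= (1 + L * h) ^+ k * (1 + eta * (k%:R * h)).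
  have := K n.+1 (leqnn _); rewrite -TE => /le_trans; apply.
  have -> : expR (L * T) + e = expR (L * T) * (1 + eta * T).
    by rewrite /eta; field; rewrite !gt_eqF ?expR_gt0.
  rewrite ler_wpM2r//; first by rewrite addr_ge0// mulr_ge0// ltW.
  have -> : L * T = n.+1%:R * (L * h) by rewrite {1}TE mulrCA.
  rewrite expRM_natl lerXn2r ?nnegrE ?expR_ge0 ?addr_ge0//.
  exact: expR_ge1Dx.
elim: k => [_|k IH kn]; first by rewrite mul0r mulr0 addr0 expr0 mulr1.
have kh0 : 0 <= k%:R * h by rewrite mulr_ge0// ltW.
have kE : k.+1%:R * h = k%:R * h + h by rewrite -natr1 mulrDl mul1r.
rewrite kE; apply: le_trans (Hh _ _ kh0 (ltW hp) hh0 _) _.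
  by rewrite -kE TE ler_wpM2r ?(ltW hp)// ler_nat.
have {}IH := IH (ltnW kn).
apply: (@le_trans _ _ ((1 + L * h) * ((1 + L * h) ^+ k * (1 + eta * (k%:R * h))) + eta * h)).
  by rewrite lerD2r ler_wpM2l// addr_ge0.
rewrite exprS; set q := (1 + L * h) ^+ k; set p := 1 + L * h.
have pq1 : 1 <= p * q.
  by rewrite /p /q -exprS exprn_ege1// lerDl.
have -> : p * q * (1 + eta * (k%:R * h + h)) =
  p * (q * (1 + eta * (k%:R * h))) + p * q * (eta * h) by ring.
by rewrite lerD2l ler_peMl// mulr_ge0// ltW.
Qed.

(** Expand the square of f (t + h) = f t + h g t + o(h); the term of order h is
2 h int g f, which the form bound controls, and the remainder is o(h) in mean
because f and g are bounded. *)
Lemma sqr_mean_growth d (T : measurableType d) (R : realType)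
    (mu : {measure set T -> \bar R}) (mu1 : mu setT = 1%E)
    (f g : R -> T -> R) (t0 K L : R) : 0 < t0 -> 0 < K -> 0 <= L ->
  (forall t, 0 <= t -> bmeas (f t) /\ bmeas (g t)) ->
  (forall t x, 0 <= t <= t0 -> `|f t x| <= K /\ `|g t x| <= K) ->
  (forall e : R, 0 < e -> exists2 h0 : R, 0 < h0 & forall t h : R,
    0 <= t -> 0 <= h -> h <= h0 -> t + h <= t0 ->
    \int[mu]_x `|f (t + h) x - f t x - h * g t x| <= e * h) ->
  (forall t, 0 <= t -> \int[mu]_x (g t x * f t x) <= L * \int[mu]_x (f t x ^+ 2)) ->
  \int[mu]_x (f 0 x ^+ 2) <= 1 ->
  \int[mu]_x (f t0 x ^+ 2) <= expR (2 * L * t0).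
Proof.
move=> t00 K0 L0 b bK incr form f01.
apply: (@discrete_gronwall _ (fun t => \int[mu]_x (f t x ^+ 2))) => //.
  by rewrite mulr_ge0.
move=> eta eta0.
have e0 : 0 < eta / (6 * K) by rewrite divr_gt0// mulr_gt0.
have [h0 h00 H] := incr _ e0.
exists (Num.min h0 (Num.min 1 (eta / (2 * K ^+ 2)))).
  by rewrite !lt_min h00 ltr01 divr_gt0// mulr_gt0// exprn_gt0.
move=> t h tp hp; rewrite !le_min => /and3P[hh0 hh1 hh2] tht0.
have tt0 : 0 <= t <= t0 by rewrite tp (le_trans _ tht0)// lerDl.
have thp : 0 <= t + h by rewrite addr_ge0.
have [bf bg] := b t tp; have [bfh _] := b _ thp.
pose e x := f (t + h) x - f t x - h * g t x.
have be : bmeas e by exact: (bmeasB (bmeasB bfh bf) (bmeasM (bmeas_cst h) bg)).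
have {}H : \int[mu]_x `|e x| <= eta / (6 * K) * h by exact: H.
have bne := bmeas_norm be; have bf2 := bmeasX 2 bf; have bfg := bmeasM bg bf.
have b1 := bmeasM (bmeas_cst (2 * h)) bfg.
have b2 := bmeasM (bmeas_cst (3 * K)) bne.
have b3 := bmeas_cst (T := T) (h ^+ 2 * K ^+ 2).
apply: (@le_trans _ _ (\int[mu]_x (f t x ^+ 2 + 2 * h * (g t x * f t x) +
    3 * K * `|e x| + h ^+ 2 * K ^+ 2))).
  apply: (mean_le mu1 (bmeasX 2 bfh) (bmeasD (bmeasD (bmeasD bf2 b1) b2) b3)) => x.
  have [fK gK] := bK t x tt0.
  have [fhK _] : `|f (t + h) x| <= K /\ `|g (t + h) x| <= K.
    by apply: bK; rewrite thp.
  have fE : f (t + h) x = f t x + h * g t x + e x by rewrite /e; ring.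
  have -> : f (t + h) x ^+ 2 = f t x ^+ 2 + 2 * h * (g t x * f t x) +
    (e x * (f (t + h) x + f t x + h * g t x) + h ^+ 2 * g t x ^+ 2).
    by move: fE; move: (f (t + h) x) (f t x) (g t x) (e x) => p q r z ->; ring.
  rewrite -[leRHS]addrA lerD2l; apply: lerD.
    rewrite (le_trans (ler_norm _))// normrM mulrC ler_wpM2r//.
    have -> : 3 * K = K + K + K by ring.
    rewrite (le_trans (ler_normD _ _))// lerD//.
      by rewrite (le_trans (ler_normD _ _))// lerD.
    rewrite normrM (ger0_norm hp) -[leRHS]mul1r ler_pM//.
  rewrite ler_wpM2l ?sqr_ge0// -(real_normK (num_real (g t x))).
  by rewrite lerXn2r ?nnegrE// ltW.
rewrite (meanD mu1 (bmeasD (bmeasD bf2 b1) b2) b3) (meanD mu1 (bmeasD bf2 b1) b2).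
rewrite (meanD mu1 bf2 b1) (meanZ mu1 _ bfg) (meanZ mu1 _ bne) mean_cst//.
have F := form t tp; move: F H.
move: (\int[mu]_x (f t x ^+ 2)) (\int[mu]_x (g t x * f t x)) (\int[mu]_x `|e x|).
move=> N G I F H.
have H1 : 2 * h * G <= 2 * h * (L * N) by rewrite ler_wpM2l// mulr_ge0.
have H2 : 3 * K * I <= 3 * K * (eta / (6 * K) * h) by rewrite ler_wpM2l// mulr_ge0// ltW.
have E2 : 3 * K * (eta / (6 * K) * h) = eta / 2 * h by field; rewrite gt_eqF.
have H3 : h ^+ 2 * K ^+ 2 <= eta / 2 * h.
  rewrite expr2 -mulrA mulrC ler_wpM2r// -ler_pdivlMr ?exprn_gt0//.
  by rewrite -mulrA -invfM.
have -> : (1 + 2 * L * h) * N + eta * h =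
  N + 2 * h * (L * N) + eta / 2 * h + eta / 2 * h by field.
by rewrite lerD// lerD// ?lerD2l// -E2.
Qed.

(** * The profile F and its inverse *)

Section profile.
Context {R : realType}.
Variable F : R -> \bar R.
Hypothesis hF : is_profile F.
Local Notation Fr := (fun x => fine (F x)).

Lemma profileE x : 0 < x -> F x = (Fr x)%:E.
Proof. by move=> x0; rewrite fineK// (profile_fin hF). Qed.

Lemma profile_lt x z : 0 < x -> x < z -> Fr x < Fr z.
Proof.
move=> x0 xz; rewrite -lte_fin -!profileE//; last exact: lt_trans xz.
by apply: (profile_incr hF) => //; exact: ltW.
Qed.

Lemma profile_le x z : 0 < x -> x <= z -> Fr x <= Fr z.
Proof. by move=> x0; rewrite le_eqVlt => /predU1P[->//|xz]; exact/ltW/profile_lt. Qed.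

Lemma profile_concaver p x z : 0 <= p <= 1 -> 0 < x -> 0 < z ->
  p * Fr x + (1 - p) * Fr z <= Fr (p * x + (1 - p) * z).
Proof.
move=> p01 x0 z0; have [p0 p1] := andP p01.
have q0 : 0 < p * x + (1 - p) * z.
  move: p0; rewrite le_eqVlt => /predU1P[<-|p0]; first by rewrite mul0r add0r subr0 mul1r.
  by rewrite ltr_pwDl// ?mulr_gt0// mulr_ge0 ?subr_ge0// ltW.
have := profile_concave hF p01 (ltW x0) (ltW z0).
by rewrite (profileE x0) (profileE z0) (profileE q0) -!EFinM -EFinD lee_fin.
Qed.

Lemma profile_mulr x z : 0 < x -> 0 < z -> Fr (x * z) <= Fr x + Fr z.
Proof.
move=> x0 z0; have := profileM hF x0 z0.
by rewrite (profileE x0) (profileE z0) (profileE (mulr_gt0 x0 z0)) -EFinD lee_fin.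
Qed.

Lemma profile_slope u I v : 0 < u -> u < I -> I < v ->
  (Fr v - Fr I) / (v - I) <= (Fr I - Fr u) / (I - u).
Proof.
move=> u0 uI Iv; have uv := lt_trans uI Iv.
have uv0 : 0 < v - u by rewrite subr_gt0.
have Iu0 : 0 < I - u by rewrite subr_gt0.
have vI0 : 0 < v - I by rewrite subr_gt0.
pose p := (v - I) / (v - u).
have p01 : 0 <= p <= 1.
  by rewrite divr_ge0 ?(ltW vI0) ?(ltW uv0)// ler_pdivrMr// mul1r lerD2l lerN2 ltW.
have := profile_concaver p01 u0 (lt_trans u0 uv).
have -> : p * u + (1 - p) * v = I by rewrite /p; field; rewrite gt_eqF.
rewrite -(ler_pM2r uv0).
have -> : (p * Fr u + (1 - p) * Fr v) * (v - u) = (v - I) * Fr u + (I - u) * Fr v.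
  by rewrite /p; field; rewrite gt_eqF.
move=> H; rewrite ler_pdivrMr// mulrAC ler_pdivlMr//.
move: H; move: (Fr u) (Fr v) (Fr I) => a b c H.
by rewrite -subr_ge0; have : 0 <= c * (v - u) - ((v - I) * a + (I - u) * b);
  [rewrite subr_ge0|congr (_ <= _); ring].
Qed.

(** The slope is the right derivative of F at I, written as a supremum of
difference quotients, which is nonnegative since F increases. *)
Lemma profile_supergradient I : 0 < I ->
  exists2 p, 0 <= p & forall u, 0 < u -> Fr u <= Fr I + p * (u - I).
Proof.
move=> I0; pose A := [set s | exists2 v, I < v & s = (Fr v - Fr I) / (v - I)].
have ubA u : 0 < u -> u < I -> ubound A ((Fr I - Fr u) / (I - u)).
  by move=> u0 uI _ [v Iv ->]; exact: profile_slope.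
have I1 : I < I + 1 by rewrite ltrDl.
have A0 : A !=set0 by exists ((Fr (I + 1) - Fr I) / (I + 1 - I)); exists (I + 1).
have I2 : 0 < I / 2 by rewrite divr_gt0.
have I3 : I / 2 < I by rewrite ltr_pdivrMr// ltr_pMr// ltr1n.
have hA : has_sup A by split=> //; exists ((Fr I - Fr (I / 2)) / (I - I / 2)); exact: ubA.
have le_sup v : I < v -> (Fr v - Fr I) / (v - I) <= sup A.
  by move=> Iv; apply: sup_upper_bound => //; exists v.
exists (sup A).
  apply: le_trans (le_sup _ I1); rewrite divr_ge0 ?subr_ge0 ?(ltW I1)//.
  by rewrite profile_le// ltW.
move=> u u0; have [uI|Iu|->] := ltgtP u I; last by rewrite subrr mulr0 addr0.
  have : sup A <= (Fr I - Fr u) / (I - u) by apply: ge_sup => //; exact: ubA.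
  rewrite ler_pdivlMr ?subr_gt0// => H; rewrite -lerBlDl -opprB.
  by rewrite lerNl -mulrN opprB.
by have := le_sup u Iu; rewrite ler_pdivrMr ?subr_gt0// lerBlDl.
Qed.

Lemma profile_cont_pos (x : R) : 0 < x -> Fr z @[z --> x] --> Fr x.
Proof.
move=> x0; apply: fine_cvg; rewrite -profileE//.
have : {in `]0, +oo[%classic, continuous F}.
  have sub : (`]0%R, +oo[%classic : set R) `<=` `[0%R, +oo[%classic.
    by apply: subset_itvr; rewrite bnd_simp.
  have := continuous_subspaceW sub (profile_cont hF).
  by rewrite continuous_open_subspace//; exact: interval_open.
by apply; rewrite inE/= in_itv/= x0.
Qed.

Lemma profile_surj v : 0 <= v -> exists2 z, 1 <= z & F z = v%:E.
Proof.
move=> v0; have [M [Mr MP]] := (cvgeyPge _).1 (profile_pinfty hF) v.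
pose b := Num.max 2 (M + 1).
have b1 : 1 <= b by rewrite le_max ler1n.
have Fb : v <= Fr b.
  rewrite -lee_fin -profileE ?(lt_le_trans _ b1)//; apply: MP.
  by rewrite lt_max ltrDl ltr01 orbT.
have F1 : Fr 1 = 0 by rewrite (profile1 hF).
have cFr : {within `[1, b], continuous Fr}.
  apply: continuous_in_subspaceT => x; rewrite inE/= in_itv/= => /andP[x1 _].
  by apply: profile_cont_pos; exact: lt_le_trans x1.
have vF : Num.min (Fr 1) (Fr b) <= v <= Num.max (Fr 1) (Fr b).
  by rewrite F1 ge_min v0/= le_max Fb orbT.
have [c] := IVT b1 cFr vF.
rewrite in_itv/= => /andP[c1 _] cv; exists c => //.
by rewrite profileE ?cv//; exact: lt_le_trans c1.
Qed.

(** The nonnegative numbers are in the range of F because F 1 = 0 and F tends to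
+oo. *)
Lemma FinvP v : 0 <= v -> 1 <= Finv F v /\ F (Finv F v) = v%:E.
Proof.
move=> v0; have [z z1 Fz] := profile_surj v0.
have inj : {in `]0, +oo[%classic &, injective F}.
  move=> a b; rewrite !inE/= !in_itv/= !andbT => a0 b0.
  rewrite (profileE a0) (profileE b0) => -[] H; apply/eqP; case: ltgtP => // ab.
    by have := profile_lt a0 ab; rewrite H ltxx.
  by have := profile_lt b0 ab; rewrite H ltxx.
have -> : Finv F v = z.
  rewrite /Finv -Fz; apply: (pinvKV _ inj).
  by rewrite inE/= in_itv/= andbT (lt_le_trans _ z1).
by [].
Qed.

Lemma Finv_le v v' : 0 <= v -> v <= v' -> Finv F v <= Finv F v'.
Proof.
move=> v0 vv'; have [a1 Fa] := FinvP v0; have [b1 Fb] := FinvP (le_trans v0 vv').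
rewrite leNgt; apply/negP => /(profile_lt (lt_le_trans ltr01 b1)).
by rewrite Fa Fb/= ltNge vv'.
Qed.

Lemma measurable_Finv d (T : measurableType d) (w : T -> R) :
  measurable_fun setT w -> (forall x, 0 <= w x) ->
  measurable_fun setT (fun x => Finv F (w x)).
Proof.
move=> mw w0; have -> : (fun x => Finv F (w x)) = (fun v => Finv F (Num.max v 0)) \o w.
  by apply/funext => x /=; rewrite (max_idPl (w0 x)).
apply: measurableT_comp => //; apply: nondecreasing_measurable => // a b ab.
by apply: Finv_le; [rewrite le_max lexx orbT|rewrite ge_max !le_max ab lexx orbT].
Qed.

(** F is real-valued and continuous on ]0, +oo[; at 0 the product is 0 whatever F 0
is. *)
Lemma measurable_profile_entropy d (T : measurableType d) (w : T -> R) :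
  measurable_fun setT w -> (forall x, 0 <= w x) ->
  measurable_fun setT (fun x => w x * Fr (w x)).
Proof.
move=> mw w0; pose D : set R := `]0, +oo[%classic.
have mD : measurable_fun D Fr.
  apply: (@open_continuous_measurable_fun R D Fr); first exact: interval_open.
  by move=> x; rewrite inE /D/= in_itv/= andbT => x0; exact: profile_cont_pos.
have mF : measurable_fun setT (Fr \_ D).
  exact: (measurable_restrictT Fr (measurable_itv `]0, +oo[)).1.
have -> : (fun x => w x * Fr (w x)) = (fun x => w x * ((Fr \_ D) \o w) x).
  apply/funext => x /=; rewrite patchE /D.
  have := w0 x; rewrite le_eqVlt => /predU1P[<-|x0]; first by rewrite !mul0r.
  by rewrite mem_set//= in_itv/= x0.
by apply: measurable_funM => //; exact: measurableT_comp.
Qed.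

(** Submultiplicativity and concavity of F give a Young inequality in which the
error term is affine in (y, z): it integrates to 0 when y has mean 1 and z has
mean I, and what remains is the entropy of y plus F I. *)
Lemma profile_young W y z I p : 0 <= y -> 0 < z -> 0 <= p ->
  (forall u, 0 < u -> Fr u <= Fr I + p * (u - I)) -> W <= Fr z ->
  y * W <= y * Fr y + y * Fr I + p * (z - y * I).
Proof.
rewrite le_eqVlt => /predU1P[<-|y0] z0 p0 grad Wz.
  by rewrite !mul0r subr0 !add0r mulr_ge0// ltW.
have zy : 0 < z / y by rewrite divr_gt0.
have H1 : W <= Fr y + (Fr I + p * (z / y - I)).
  rewrite (le_trans Wz)//; have := profile_mulr y0 zy.
  rewrite mulrCA divff ?gt_eqF// mulr1 => /le_trans; apply.
  by rewrite lerD2l grad.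
have -> : y * Fr y + y * Fr I + p * (z - y * I) = y * (Fr y + (Fr I + p * (z / y - I))).
  by field; rewrite gt_eqF.
by rewrite ler_wpM2l// ltW.
Qed.

End profile.

(** * The form bound *)

Lemma integrable_le_integral d (T : measurableType d) (R : realType)
    (mu : {measure set T -> \bar R}) (f g : T -> \bar R) :
  mu.-integrable setT f -> measurable_fun setT g -> (forall x, f x <= g x)%E ->
  (\int[mu]_x f x <= \int[mu]_x g x)%E.
Proof.
move=> intf mg fg; have mf := measurable_int mu intf.
rewrite integralE [leRHS]integralE; apply: leeB; apply: ge0_le_integral => //.
- exact: measurable_funepos.
- exact: measurable_funepos.
- by move=> x _; rewrite !funeposE ge_max !le_max fg lexx orbT.
- exact: measurable_funeneg.
- exact: measurable_funeneg.
- by move=> x _; rewrite !funenegE ge_max !le_max leeN2 fg lexx orbT.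
Qed.

Section generator.
Context {R : realType} {dE dO : measure_display}.
Context {E : measurableType dE} {Omega : measurableType dO}.
Variables (X : R -> Omega -> E) (Px : R.-pker E ~> Omega).
Hypothesis hX : is_markov_process X Px.
Variable mu : probability E R.
Hypothesis hinv : invariant_measure X Px mu.
Local Notation P_ := (semigroup X Px).
Variables f g : E -> R.
Hypotheses (bf : bmeas f) (bg : bmeas g) (fg : is_generator X Px mu f g).

Let q h x := h^-1 * (P_ h f x - f x).

Let bq h : 0 < h -> bmeas (q h).
Proof.
move=> h0; apply: bmeasM; first exact: bmeas_cst.
by apply: bmeasB => //; exact: (bmeas_semigroup hX (ltW h0) bf).
Qed.

(** The difference quotients converge in L^1 to every version of the generator,
hence all versions agree almost everywhere. *)
Lemma generator_L1 (g' : E -> R) : is_generator X Px mu f g' ->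
  measurable_fun setT g' /\ forall e : R, 0 < e -> exists2 h0 : R, 0 < h0 &
    forall h : R, 0 < h -> h <= h0 -> (\int[mu]_x `|q h x - g' x|%:E <= e%:E)%E.
Proof.
move=> [_ Lg' cg']; have mg' : measurable_fun setT g'.
  by move: Lg'; rewrite inE/= => /andP[]; rewrite inE.
split=> //; apply: (@Lnorm2_cvg0_abs_mean _ _ _ mu (fun h x => q h x - g' x)) => //.
by move=> h h0; apply: measurable_funB => //; exact: (bq h0).1.
Qed.

Lemma genL_ae : measurable_fun setT (genL X Px mu f) /\
  (\int[mu]_x `|genL X Px mu f x - g x|%:E = 0)%E.
Proof.
have fL : is_generator X Px mu f (genL X Px mu f) by apply: xgetPex; exists g.
move: (genL X Px mu f) fL => L fL.
have [mL HL] := generator_L1 fL; have [mg Hg] := generator_L1 fg; split=> //.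
have md : measurable_fun setT (fun x => `|L x - g x|%:E).
  by apply/measurable_EFinP; apply: measurableT_comp => //; exact: measurable_funB.
apply/eqP; rewrite eq_le; apply/andP; split; last first.
  by apply: integral_ge0 => x _; rewrite lee_fin.
apply/lee_addgt0Pr => e e0; rewrite add0e; have e2 : 0 < e / 2 by rewrite divr_gt0.
have [h1 h10 H1] := HL _ e2; have [h2 h20 H2] := Hg _ e2.
(* Both limits are compared with the same difference quotient. *)
pose h := Num.min h1 h2; have h0 : 0 < h by rewrite lt_min h10.
have hh1 : h <= h1 by rewrite ge_min lexx.
have hh2 : h <= h2 by rewrite ge_min lexx orbT.
have mq := (bq h0).1.
have m1 : measurable_fun setT (fun x => `|q h x - L x|%:E).
  by apply/measurable_EFinP; apply: measurableT_comp => //; exact: measurable_funB.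
have m2 : measurable_fun setT (fun x => `|q h x - g x|%:E).
  by apply/measurable_EFinP; apply: measurableT_comp => //; exact: measurable_funB.
apply: (@le_trans _ _ (\int[mu]_x (`|q h x - L x|%:E + `|q h x - g x|%:E))%E).
  apply: ge0_le_integral => //; first exact: emeasurable_funD.
  move=> x _; rewrite -EFinD lee_fin.
  have -> : L x - g x = (q h x - g x) - (q h x - L x) by ring.
  by rewrite (le_trans (ler_normB _ _))// addrC.
rewrite ge0_integralD//.
have -> : e = e / 2 + e / 2 by field.
by rewrite EFinD; apply: leeD; [exact: H1|exact: H2].
Qed.

(** The functional inequalities are stated for a version of L f that is chosen
arbitrarily; the inner product does not depend on the choice. *)
Lemma inner_genL (k : E -> R) : bmeas k ->
  inner mu (genL X Px mu f) k = \int[mu]_x (g x * k x).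
Proof.
move=> bk; have [mL H] := genL_ae; rewrite /inner /Rintegral; congr fine.
move: (genL X Px mu f) mL H => L mL H.
apply: ae_eq_integral => //.
- by apply/measurable_EFinP; apply: measurable_funM => //; exact: bk.1.
- by apply/measurable_EFinP; apply: measurable_funM; [exact: bg.1|exact: bk.1].
have md : measurable_fun setT (fun x => (L x - g x)%:E).
  by apply/measurable_EFinP; apply: measurable_funB => //; exact: bg.1.
have /(ae_eq_integral_abs mu measurableT md) : (\int[mu]_x `|(L x - g x)%:E| = 0)%E by exact: H.
apply: filterS => x /= /(_ I) [] /eqP; rewrite subr_eq0 => /eqP -> _ //.
Qed.

(** Invariance of mu: the difference quotients have mean 0. *)
Lemma generator_mean0 : \int[mu]_x g x = 0.
Proof.
apply/eqP; rewrite -normr_eq0 eq_le normr_ge0 andbT.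
apply/ler_addgt0Pr => e e0; rewrite add0r.
have [_ H] := generator_L1 fg; have [h h0 {}H] := H e e0.
have bqg := bmeasB (bq h0) bg.
have {}H : \int[mu]_x `|q h x - g x| <= e.
  by rewrite -lee_fin -bmeas_EFin//; [exact: H|exact: bmeas_norm].
apply: le_trans H; apply: le_trans (mean_norm (prob_measT mu) bqg).
have bP := bmeas_semigroup hX (ltW h0) bf.
rewrite (meanB (prob_measT mu) (bq h0) bg) /q.
rewrite (meanZ (prob_measT mu) _ (bmeasB bP bf)) (meanB (prob_measT mu) bP bf).
by rewrite (semigroup_mean hX hinv (ltW h0) bf) subrr mulr0 sub0r normrN.
Qed.

(** Constants are in the kernel of L. This allows centring and normalising f before
the F-Sobolev inequality is applied. *)
Lemma generator_affine (c a : R) : 0 < c ->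
  is_generator X Px mu (fun x => c * (f x - a)) (fun x => c * g x).
Proof.
move=> c0; split.
- apply: bmeas_Lfun2; exact: (bmeasM (bmeas_cst c) (bmeasB bf (bmeas_cst a))).
- apply: bmeas_Lfun2; exact: (bmeasM (bmeas_cst c) bg).
apply/cvg_at_right0P => [h|e e0]; first exact: Lnorm_ge0.
have ecp : 0 < e / c by rewrite divr_gt0.
have [_ _ /(cvg_at_right0P (fun h => Lnorm_ge0 _ _ _)) H] := fg.
have [h0 h00 {}H] := H _ ecp.
exists h0 => // h hp hh0; have ec := ltW ecp.
have bqg := bmeasB (bq hp) bg; have bqg2 := bmeasX 2 bqg.
have := H h hp hh0; rewrite (Lnorm2_le _ _ ec) (Lnorm2_le _ _ (ltW e0)) => {}H.
have E1 x : h^-1 * (P_ h (fun x => c * (f x - a)) x - c * (f x - a)) - c * g x =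
    c * (q h x - g x).
  have bfh := bmeas_path hX (ltW hp) bf.
  rewrite /q /semigroup (meanZ (prob_kernel x) _ (bmeasB bfh (bmeas_cst a))).
  rewrite (meanB (prob_kernel x) bfh (bmeas_cst a)) (mean_cst (prob_kernel x)).
  by move: (\int[Px x]_w f (X h w)) (f x) (g x) => u v z; ring.
under eq_integral do rewrite E1 exprMn.
rewrite (bmeas_EFin (prob_measT mu)); last exact: (bmeasM (bmeas_cst (c ^+ 2)) bqg2).
have {}H : \int[mu]_x ((q h x - g x) ^+ 2) <= (e / c) ^+ 2.
  by rewrite -lee_fin -(bmeas_EFin (prob_measT mu) bqg2).
rewrite lee_fin (meanZ (prob_measT mu) _ bqg2).
have -> : e ^+ 2 = c ^+ 2 * (e / c) ^+ 2 by field; rewrite gt_eqF.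
by rewrite ler_wpM2l// sqr_ge0.
Qed.

End generator.

(** The entropy bounds the mean of W g^2: integrate [profile_young] with y = g^2,
z = F^{-1}(w) and I the mean of z. All terms but the entropy are
integrable, while the entropy itself may only be bounded above; hence the
inequality is arranged as l <= k with l integrable. *)
Lemma profile_entropy_dual d (T : measurableType d) (R : realType)
    (mu : probability T R) (F : R -> \bar R) (hF : is_profile F)
    (g W w : T -> R) (D kappa : R) : bmeas g -> bmeas W ->
  measurable_fun setT w -> (forall x, 0 <= w x) -> (forall x, W x <= w x) ->
  (Fext F (\int[mu]_x (Finv F (w x))%:E) <= kappa%:E)%E ->
  \int[mu]_x (g x ^+ 2) = 1 ->
  (\int[mu]_x ((g x ^+ 2)%:E * F (g x ^+ 2)%R) <= D%:E)%E ->
  \int[mu]_x (W x * g x ^+ 2) <= D + kappa.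
Proof.
move=> bg bW mw w0 Ww Fk g1 ent.
pose z x := Finv F (w x).
have zP x := FinvP hF (w0 x).
have mz : measurable_fun setT z by exact: (measurable_Finv hF mw w0).
have z1 x : 1 <= z x by case: (zP x).
have z0 x : 0 < z x by exact: lt_le_trans (z1 x).
have iz : mu.-integrable setT (EFin \o z).
  apply/integrableP; split; first exact/measurable_EFinP.
  under eq_integral do rewrite /= ger0_norm ?(ltW (z0 _))//.
  by move: Fk; rewrite -/z; case: (\int[mu]_x _)%E => //= r _; rewrite ltry.
pose I := \int[mu]_x z x.
have IE : (\int[mu]_x (z x)%:E = I%:E)%E.
  by rewrite /I /Rintegral fineK//; exact: integrable_fin_num.
have bg2 := bmeasX 2 bg.
have I1 : 1 <= I.
  rewrite -(mean_cst (prob_measT mu) 1); apply: le_Rintegral => //.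
  exact: (bmeas_integrableP (prob_measT mu) (bmeas_cst 1)).
have I0 : 0 < I by exact: lt_le_trans I1.
have FI : fine (F I) <= kappa.
  by move: Fk; rewrite IE /= (profileE hF I0) lee_fin.
have [p p0 grad] := profile_supergradient hF I0.
pose l x := W x * g x ^+ 2 - fine (F I) * g x ^+ 2 - p * (z x - g x ^+ 2 * I).
pose k x := g x ^+ 2 * fine (F (g x ^+ 2)).
have lk x : l x <= k x.
  have := profile_young hF (sqr_ge0 (g x)) (z0 x) p0 grad (W := W x).
  have -> : fine (F (z x)) = w x by rewrite (proj2 (zP x)).
  move=> /(_ (Ww x)); rewrite /l /k.
  move: (fine (F (g x ^+ 2))) (g x ^+ 2) (z x) (W x) (fine (F I)) => a b c e f; lra.
have mk : measurable_fun setT k.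
  by apply: (measurable_profile_entropy hF) => [|x]; [exact: bg2.1|exact: sqr_ge0].
have kE x : ((g x ^+ 2)%:E * F (g x ^+ 2)%R = (k x)%:E)%E.
  have := sqr_ge0 (g x); rewrite le_eqVlt /k => /predU1P[<-|gx0]; first by rewrite mul0e mul0r.
  by rewrite {1}(profileE hF gx0) EFinM.
have bWg := bmeasM bW bg2.
have bFg := bmeasM (bmeas_cst (fine (F I))) bg2.
have bgI := bmeasM bg2 (bmeas_cst I).
have i1 := bmeas_integrableP (prob_measT mu) (bmeasB bWg bFg).
have i2 := bmeas_integrableP (prob_measT mu) bgI.
have i3 : mu.-integrable setT (EFin \o (fun x => z x - g x ^+ 2 * I)).
  exact: (integrableB measurableT iz i2).
have i4 : mu.-integrable setT (EFin \o (fun x => p * (z x - g x ^+ 2 * I))).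
  exact: (integrableZl measurableT p i3).
have il : mu.-integrable setT (EFin \o l) by exact: (integrableB measurableT i1 i4).
have lint : \int[mu]_x l x = \int[mu]_x (W x * g x ^+ 2) - fine (F I).
  rewrite /l (RintegralB measurableT i1 i4) (RintegralZl p measurableT i3).
  rewrite (RintegralB measurableT iz i2) (meanB (prob_measT mu) bWg bFg).
  rewrite (meanZ (prob_measT mu) _ bg2) g1.
  under [X in _ - p * (_ - X)]eq_Rintegral do rewrite mulrC.
  by rewrite (meanZ (prob_measT mu) _ bg2) g1 !mulr1 -/I subrr mulr0 subr0.
have lD : (\int[mu]_x (l x)%:E <= D%:E)%E.
  apply: le_trans ent; under [leRHS]eq_integral do rewrite kE.
  by apply: (integrable_le_integral il); [exact/measurable_EFinP|move=> x; rewrite lee_fin].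
have {}lD : \int[mu]_x l x <= D.
  by rewrite -lee_fin /Rintegral fineK//; exact: (integrable_fin_num measurableT il).
by move: lD; rewrite lint lerBlDr => /le_trans; apply; rewrite lerD2l.
Qed.

Section form_bound.
Context {R : realType} {dE dO : measure_display}.
Context {E : measurableType dE} {Omega : measurableType dO}.
Variables (X : R -> Omega -> E) (Px : R.-pker E ~> Omega).
Hypothesis hX : is_markov_process X Px.
Variable mu : probability E R.
Hypothesis hinv : invariant_measure X Px mu.
Variables (F : R -> \bar R) (CP : R).
Hypotheses (hF : is_profile F) (hFS : F_sobolev X Px mu F).
Hypotheses (CP0 : 0 < CP) (hP : poincare X Px mu CP).
Let kappa := (4 * CP)^-1.

Variables (U w : E -> R) (eps M2 : R).
Hypotheses (bU : bmeas U) (mw : measurable_fun setT w) (w0 : forall x, 0 <= w x).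
Hypothesis Uw : forall x, kappa < U x -> 2 * U x <= w x.
Hypothesis Fw : (Fext F (\int[mu]_x (Finv F (w x))%:E) <= kappa%:E)%E.
Hypotheses (U1 : \int[mu]_x U x <= eps) (U2 : \int[mu]_x (U x ^+ 2) <= M2).
Hypotheses (eps0 : 0 <= eps) (M20 : 0 <= M2).

Lemma poincare_bmeas (f g : E -> R) : bmeas f -> bmeas g ->
  is_generator X Px mu f g ->
  \int[mu]_x ((f x - \int[mu]_x f x) ^+ 2) <= CP * - (\int[mu]_x (g x * f x)).
Proof.
move=> bf bg fg; have := hP (ex_intro _ g fg).
rewrite (inner_genL hX bf bg fg bf) mulNr -mulrN => H.
rewrite -lee_fin; apply: le_trans H.
have bfa := bmeasB bf (bmeas_cst (\int[mu]_x f x)).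
rewrite -(bmeas_EFin (prob_measT mu) (bmeasX 2 bfa)).
rewrite /variance covariance.unlock !expectation.unlock.
by rewrite le_eqVlt; apply/orP; left; apply/eqP; apply: eq_integral => x _.
Qed.

Let B := U @^-1` `]kappa, +oo[%classic.
Let W x := 2 * U x * \1_B x.

Let bW : bmeas W.
Proof.
apply: bmeasM; first exact: (bmeasM (bmeas_cst 2) bU).
by apply: bmeas_indic; rewrite -[X in measurable X]setTI; exact: bU.1.
Qed.

Let W_cases x : (kappa < U x /\ W x = 2 * U x) \/ (U x <= kappa /\ W x = 0).
Proof.
have [h|h] := ltP kappa (U x); [left|right]; split=> //; rewrite /W indicE.
  by rewrite mem_set ?mulr1// /B/= in_itv/= h.
by rewrite memNset ?mulr0// /B/= in_itv/= andbT ltNge h.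
Qed.

Let W_le x : W x <= w x.
Proof. by have [[h ->]|[_ ->]] := W_cases x; [exact: Uw|exact: w0]. Qed.

Let U_le x : U x <= kappa + W x / 2.
Proof.
have k0 : 0 < kappa by rewrite invr_gt0 mulr_gt0.
by have [[h ->]|[h ->]] := W_cases x; lra.
Qed.

(** F-Sobolev for f - a normalised in L^2, multiplied back by its squared norm S. If
S = 0 the left-hand side vanishes, and D >= 0 by the Poincare inequality. *)
Lemma large_part_bound (f g : E -> R) (a : R) : bmeas f -> bmeas g ->
  is_generator X Px mu f g -> a = \int[mu]_x f x ->
  \int[mu]_x (W x * (f x - a) ^+ 2) <=
    - (\int[mu]_x (g x * f x)) + kappa * \int[mu]_x ((f x - a) ^+ 2).
Proof.
move=> bf bg fg aE.
set S := \int[mu]_x ((f x - a) ^+ 2); set D := - (\int[mu]_x (g x * f x)).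
have bfa : bmeas (fun x => f x - a) by exact: (bmeasB bf (bmeas_cst a)).
have bfa2 := bmeasX 2 bfa; have bgf := bmeasM bg bf.
have SD : S <= CP * D by rewrite /S /D aE; exact: poincare_bmeas.
have S0 : 0 <= S by apply: mean_ge0 => x; exact: sqr_ge0.
have [Sz|Sp] := leP S 0.
  have S00 : S = 0 by apply/eqP; rewrite eq_le Sz S0.
  have D0 : 0 <= D by rewrite -(pmulr_rge0 _ CP0) -S00.
  rewrite S00 mulr0 addr0 (le_trans _ D0)//.
  under eq_Rintegral do rewrite mulrC.
  rewrite (mean_null_mul bfa2 bW)//.
  by under eq_Rintegral do rewrite ger0_norm ?sqr_ge0//.
(* c normalises f - a in L^2. *)
pose c := (Num.sqrt S)^-1; have c0 : 0 < c by rewrite invr_gt0 sqrtr_gt0.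
have c2 : c ^+ 2 = S^-1 by rewrite exprVn sqr_sqrtr// ltW.
have gen := generator_affine hX bf bg fg a c0.
have bh := bmeasM (bmeas_cst c) bfa; have bcg := bmeasM (bmeas_cst c) bg.
have h1 : \int[mu]_x ((c * (f x - a)) ^+ 2) = 1.
  under eq_Rintegral do rewrite exprMn.
  by rewrite (meanZ (prob_measT mu) _ bfa2) c2 mulVf// gt_eqF.
have := hFS (ex_intro _ _ gen) h1.
rewrite (inner_genL hX bh bcg gen bh).
have -> : \int[mu]_x (c * g x * (c * (f x - a))) = - D / S.
  transitivity (\int[mu]_x (S^-1 * (g x * f x - a * g x))).
    by apply: eq_Rintegral => x _; rewrite -c2; ring.
  have bag := bmeasM (bmeas_cst a) bg.
  rewrite (meanZ (prob_measT mu) _ (bmeasB bgf bag)) (meanB (prob_measT mu) bgf bag).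
  rewrite (meanZ (prob_measT mu) _ bg) (generator_mean0 hX hinv bf bg fg).
  by rewrite mulr0 subr0 mulrC /D opprK.
rewrite mulNr opprK => ent.
have := profile_entropy_dual hF bh bW mw w0 W_le Fw h1 ent.
have -> : \int[mu]_x (W x * (c * (f x - a)) ^+ 2) = S^-1 * \int[mu]_x (W x * (f x - a) ^+ 2).
  rewrite -(meanZ (prob_measT mu) _ (bmeasM bW bfa2)).
  by apply: eq_Rintegral => x _; rewrite exprMn c2; ring.
rewrite mulrC ler_pdivrMr// mulrDl divfK ?gt_eqF//.
Qed.

(** Decompose U f^2 around the mean a of f. With S the variance of f and
D = - <L f, f>, the terms in f - a cost S / (8 CP) (cross term), kappa S (where
U <= kappa) and half of D + kappa S (where U > kappa, by [large_part_bound]);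
as S <= CP D, they add up to at most D. What is left is
a^2 (eps + 8 CP M2), and a^2 is at most the mean of f^2. *)
Lemma form_bound (f g : E -> R) : bmeas f -> bmeas g ->
  is_generator X Px mu f g ->
  \int[mu]_x (g x * f x) + \int[mu]_x (U x * f x ^+ 2) <=
    (eps + 8 * CP * M2) * \int[mu]_x (f x ^+ 2).
Proof.
move=> bf bg fg; pose a := \int[mu]_x f x.
have bfa : bmeas (fun x => f x - a) by exact: (bmeasB bf (bmeas_cst a)).
have bfa2 := bmeasX 2 bfa; have bf2 := bmeasX 2 bf; have bU2 := bmeasX 2 bU.
have bWf := bmeasM bW bfa2.
have := large_part_bound bf bg fg (erefl a); have := poincare_bmeas bf bg fg.
rewrite -/a /=.
pose S := \int[mu]_x ((f x - a) ^+ 2).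
have SE : S = \int[mu]_x (f x ^+ 2) - a ^+ 2.
  have baf := bmeasM (bmeas_cst (2 * a)) bf.
  transitivity (\int[mu]_x (f x ^+ 2 - 2 * a * f x + a ^+ 2)).
    by apply: eq_Rintegral => x _; ring.
  rewrite (meanD (prob_measT mu) (bmeasB bf2 baf) (bmeas_cst (a ^+ 2))).
  rewrite (meanB (prob_measT mu) bf2 baf) (meanZ (prob_measT mu) _ bf).
  by rewrite (mean_cst (prob_measT mu)) -/a; ring.
have S0 : 0 <= S by apply: mean_ge0 => x; exact: sqr_ge0.
have b1 := bmeasM (bmeas_cst (a ^+ 2)) bU.
have b2 := bmeasM (bmeas_cst (8 * CP * a ^+ 2)) bU2.
have b3 := bmeasM (bmeas_cst ((8 * CP)^-1 + kappa)) bfa2.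
have b4 := bmeasM (bmeas_cst 2^-1) bWf.
have b12 := bmeasD b1 b2; have b123 := bmeasD b12 b3; have b1234 := bmeasD b123 b4.
have CP1 : 0 < 8 * CP by rewrite mulr_gt0.
have UF : \int[mu]_x (U x * f x ^+ 2) <= a ^+ 2 * \int[mu]_x U x +
    8 * CP * a ^+ 2 * \int[mu]_x (U x ^+ 2) + ((8 * CP)^-1 + kappa) * S +
    2^-1 * \int[mu]_x (W x * (f x - a) ^+ 2).
  rewrite /S -(meanZ (prob_measT mu) _ bU) -(meanZ (prob_measT mu) _ bU2).
  rewrite -(meanZ (prob_measT mu) _ bfa2) -(meanZ (prob_measT mu) _ bWf).
  rewrite -(meanD (prob_measT mu) b1 b2) -(meanD (prob_measT mu) b12 b3).
  rewrite -(meanD (prob_measT mu) b123 b4).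
  apply: (mean_le (prob_measT mu) (bmeasM bU bf2) b1234) => x.
  have := U_le x; move: (W x) (U x) (f x) => W' u f' uW.
  pose z := f' - a.
  have -> : u * f' ^+ 2 = a ^+ 2 * u + 2 * (a * u) * z + u * z ^+ 2 by rewrite /z; ring.
  rewrite -/z -!addrA lerD2l.
  have y1 : 2 * (a * u) * z <= 8 * CP * a ^+ 2 * u ^+ 2 + (8 * CP)^-1 * z ^+ 2.
    rewrite -subr_ge0.
    have -> : 8 * CP * a ^+ 2 * u ^+ 2 + (8 * CP)^-1 * z ^+ 2 - 2 * (a * u) * z =
      (8 * CP * (a * u) - z) ^+ 2 / (8 * CP) by field; rewrite gt_eqF.
    by rewrite divr_ge0 ?sqr_ge0// ltW.
  have y2 : u * z ^+ 2 <= kappa * z ^+ 2 + 2^-1 * (W' * z ^+ 2).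
    have -> : kappa * z ^+ 2 + 2^-1 * (W' * z ^+ 2) = (kappa + W' / 2) * z ^+ 2 by ring.
    by rewrite ler_wpM2r// sqr_ge0.
  rewrite [X in _ <= X](_ : _ = (8 * CP * a ^+ 2 * u ^+ 2 + (8 * CP)^-1 * z ^+ 2) +
    (kappa * z ^+ 2 + 2^-1 * (W' * z ^+ 2))); last by ring.
  exact: lerD.
move: UF SE S0; rewrite -/S.
move: (\int[mu]_x (U x * f x ^+ 2)) (\int[mu]_x (f x ^+ 2))
  (\int[mu]_x (W x * (f x - a) ^+ 2)) (\int[mu]_x (g x * f x)) S U1 U2.
move: (\int[mu]_x U x) (\int[mu]_x (U x ^+ 2)).
move=> u1 u2 UF F2 WF G S U1' U2' H SE S0 SD WD.
have a2 := sqr_ge0 a.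
have e1 : a ^+ 2 * u1 <= a ^+ 2 * eps by rewrite ler_wpM2l.
have e2 : 8 * CP * a ^+ 2 * u2 <= 8 * CP * a ^+ 2 * M2.
  by rewrite ler_wpM2l// mulr_ge0// ltW.
(* This is the count 1/8 + 1/4 + 1/8 = 1/2 of the multiples of S / CP. *)
have e3 : (8 * CP)^-1 * S + kappa * S + kappa * S / 2 = S / CP / 2.
  by rewrite /kappa; field; rewrite gt_eqF.
have e4 : S / CP <= - G by rewrite ler_pdivrMr// mulrC.
have e5 : a ^+ 2 * eps + 8 * CP * a ^+ 2 * M2 = (eps + 8 * CP * M2) * a ^+ 2 by ring.
have e6 : (eps + 8 * CP * M2) * a ^+ 2 <= (eps + 8 * CP * M2) * F2.
  rewrite ler_wpM2l//; last by lra.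
  by rewrite addr_ge0// mulr_ge0// ltW.
have e7 : ((8 * CP)^-1 + kappa) * S = (8 * CP)^-1 * S + kappa * S by rewrite mulrDl.
rewrite e7 in H; move: H WD e1 e2 e3 e4 e5 e6.
move: ((8 * CP)^-1 * S) (kappa * S) (S / CP) ((eps + 8 * CP * M2) * F2) => s1 s2 s3 s4.
move: (a ^+ 2 * u1) (8 * CP * a ^+ 2 * u2) => s5 s6.
move: (a ^+ 2 * eps) (8 * CP * a ^+ 2 * M2) ((eps + 8 * CP * M2) * a ^+ 2) => s7 s8 s9.
by move=> H WD e1 e2 e3 e4 e5 e6; lra.
Qed.

End form_bound.

(** * The exponential bound for a bounded potential *)

Section deviation.
Context {R : realType} {dE dO : measure_display}.
Context {E : measurableType dE} {Omega : measurableType dO}.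
Variables (X : R -> Omega -> E) (Px : R.-pker E ~> Omega).
Hypothesis hX : is_markov_process X Px.
Variable mu : probability E R.
Hypothesis hinv : invariant_measure X Px mu.
Hypothesis hcont : strongly_continuous X Px mu.
Variables (nu : probability E R) (hnu : nu `<< mu).
Local Notation N2 := ('N[mu]_2%:E['d (charge_of_finite_measure nu) '/d mu])%E.

Section bounded_potential.
Variables (U : E -> R) (C L : R).
Hypotheses (bU : bmeas U) (C0 : 0 < C) (UC : forall x, `|U x| <= C) (L0 : 0 <= L).
Hypothesis form : forall f g : E -> R, bmeas f -> bmeas g ->
  is_generator X Px mu f g ->
  \int[mu]_x (g x * f x) + \int[mu]_x (U x * f x ^+ 2) <= L * \int[mu]_x (f x ^+ 2).

Lemma fk0 x : fk X Px U 0 x = 1.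
Proof.
rewrite /fk -(mean_cst (prob_kernel (s := Px) x) 1).
apply: eq_Rintegral => w _.
have := potential_tint_bound hX bU UC w (lexx 0); rewrite subrr mulr0 normr_le0 => /eqP ->.
by rewrite expR0.
Qed.

(** The form bound for f = fk s is exactly the growth condition for the second
moment, since fkU s = L (fk s) + U (fk s). *)
Lemma fk_sqr_mean t : 0 < t ->
  \int[mu]_x (fk X Px U t x ^+ 2) <= expR (2 * L * t).
Proof.
move=> t0; have Ct : 0 < expR (C * t) * (1 + C).
  by rewrite mulr_gt0 ?expR_gt0// addr_gt0.
apply: (sqr_mean_growth (prob_measT mu) (g := fkU X Px U) t0 Ct L0).
- by move=> s s0; split; [exact: bmeas_fk|exact: bmeas_fkU].
- move=> s x /andP[s0 st].
  have Cst : expR (C * s) <= expR (C * t) by rewrite ler_expR ler_pM2l.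
  split; [rewrite (le_trans (fk_bound hX bU UC x s0))//|
          rewrite (le_trans (fkU_bound hX bU UC x s0))//].
    by rewrite (le_trans Cst)// ler_peMr ?expR_ge0// lerDl ltW.
  by apply: ler_pM; rewrite ?expR_ge0 ?(ltW C0)// lerDr.
- move=> e e0; have e1 : 0 < e / expR (C * t) by rewrite divr_gt0 ?expR_gt0.
  have [h0 h00 H] := fk_increment hX hinv hcont bU C0 UC e1.
  exists h0 => // s h s0 hp hh0 sht; apply: le_trans (H s h s0 hp hh0) _.
  have -> : e * h = expR (C * t) * (e / expR (C * t) * h).
    by field; rewrite gt_eqF// expR_gt0.
  rewrite ler_wpM2r//; first by rewrite mulr_ge0// ltW.
  by rewrite ler_expR ler_pM2l// (le_trans _ sht)// lerDl.
- move=> s s0; have bF := bmeas_fk hX bU s0; have bFU := bmeas_fkU hX bU s0.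
  have gen := fk_generator hX hinv hcont bU C0 UC s0.
  move: (fk X Px U s) (fkU X Px U s) bF bFU gen => f g bf bg gen.
  have bUf := bmeasM bU bf; have bUf2 := bmeasM bU (bmeasX 2 bf).
  apply: le_trans (form bf (bmeasB bg bUf) gen).
  rewrite -(meanD (prob_measT mu) (bmeasM (bmeasB bg bUf) bf) bUf2).
  rewrite le_eqVlt; apply/orP; left; apply/eqP; apply: eq_Rintegral => x _; ring.
- under eq_Rintegral do rewrite fk0 expr1n.
  by rewrite mean_cst.
Qed.

End bounded_potential.

(** Cauchy-Schwarz in L^2(mu) against the density of nu, whose norm may be infinite. *)
Lemma mean_density (f : E -> R) (s : R) : bmeas f -> 0 <= s ->
  \int[mu]_x (f x ^+ 2) <= s ^+ 2 ->
  (\int[nu]_x (f x)%:E <= N2 * s%:E)%E.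
Proof.
move=> bf s0 fs; pose D := 'd (charge_of_finite_measure nu) '/d mu.
have DE : D = EFin \o (fine \o D).
  by apply/funext => x /=; rewrite fineK//; exact: Radon_Nikodym_fin_num.
have mD : measurable_fun setT D.
  have H : mu.-integrable setT D by apply: Radon_Nikodym_integrable. exact: (measurable_int mu H).
have mfD : measurable_fun setT (fine \o D).
  by apply: measurableT_comp.
rewrite -(Radon_Nikodym_change_of_variables hnu measurableT); last first.
  exact: (bmeas_integrableP (prob_measT nu) bf).
have half : 2^-1 + 2^-1 = 1 :> R by field.
have := @hoelder _ E R mu f (fine \o D) 2 2 bf.1 mfD (ltr0n _ 2) (ltr0n _ 2) half.
rewrite Lnorm1 -DE => H.
have fs2 : ('N[mu]_2%:E[EFin \o f] <= s%:E)%E.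
  by rewrite Lnorm2_le// (bmeas_EFin (prob_measT mu) (bmeasX 2 bf)) lee_fin.
apply: (@le_trans _ _ ('N[mu]_2%:E[EFin \o f] * N2)%E); last first.
  by rewrite muleC lee_wpmul2l// Lnorm_ge0.
apply: le_trans H; rewrite -/D.
apply: (le_trans (lee_abs _)).
have -> : (fun x => (f x)%:E * D x)%E = EFin \o (f \* (fine \o D))%R.
  by apply/funext => x; rewrite {1}DE /= EFinM.
apply: le_abse_integral => //; apply/measurable_EFinP.
by apply: measurable_funM => //; exact: bf.1.
Qed.

Lemma density_norm_ge1 : (1 <= N2)%E.
Proof.
have := @mean_density (fun=> 1) 1 (bmeas_cst 1) ler01.
rewrite (bmeas_EFin (prob_measT nu) (bmeas_cst 1)) !mean_cst// mule1; apply.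
by rewrite expr1n.
Qed.

Lemma init_law_le1 (A : set Omega) : measurable A -> (law_from Px nu A <= 1)%E.
Proof. by move=> mA; have := probability_le1 (init_law Px nu) mA. Qed.

(** The exponential Markov inequality conditionally on the starting point x bounds
the probability by exp(- b) fk t x; then [mean_density] and [fk_sqr_mean]. *)
Lemma chernoff_bounded (U : E -> R) (C L t b : R) : bmeas U -> 0 < C ->
  (forall x, `|U x| <= C) -> 0 <= L ->
  (forall f g : E -> R, bmeas f -> bmeas g -> is_generator X Px mu f g ->
    \int[mu]_x (g x * f x) + \int[mu]_x (U x * f x ^+ 2) <=
      L * \int[mu]_x (f x ^+ 2)) ->
  0 < t ->
  (law_from Px nu [set w | (b <= tint (potential X U) 0 t w)%R] <=
   N2 * (expR (L * t - b))%:E)%E.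
Proof.
move=> bU C0 UC L0 form t0.
have bt := bmeas_tint (potential_jointly hX bU) (ltW t0).
pose A := [set w | b <= tint (potential X U) 0 t w].
have mA : measurable A.
  have -> : A = tint (potential X U) 0 t @^-1` `[b, +oo[%classic.
    by apply/seteqP; split=> w /=; rewrite in_itv/= andbT.
  by rewrite -[X in measurable X]setTI; exact: bt.1.
have bF := bmeas_fk hX bU (ltW t0).
have bf : bmeas (fun x => expR (- b) * fk X Px U t x) by exact: (bmeasM (bmeas_cst _) bF).
have PA x : (Px x A <= (expR (- b) * fk X Px U t x)%:E)%E.
  have bE := bmeas_exp bt.
  have -> : Px x A = (\int[Px x]_w \1_A w)%:E.
    by rewrite mean_indic// fineK//; exact: finite_kernel_measure.
  rewrite lee_fin /fk -(meanZ (prob_kernel x) _ bE).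
  apply: (mean_le (prob_kernel x) (bmeas_indic mA) (bmeasM (bmeas_cst _) bE)) => w.
  rewrite indicE -expRD; have [wA|wA] := boolP (w \in A); last by rewrite expR_ge0.
  by rewrite -expR0 ler_expR addrC subr_ge0; move: wA; rewrite inE.
apply: (@le_trans _ _ (\int[nu]_x (expR (- b) * fk X Px U t x)%:E)%E).
  apply: ge0_le_integral => //; first exact: measurable_kernel.
  by apply/measurable_EFinP; exact: bf.1.
apply: mean_density => //.
have -> : expR (L * t - b) ^+ 2 = expR (- b) ^+ 2 * expR (2 * L * t).
  by rewrite -!expRM_natl -expRD; congr expR; ring.
under eq_Rintegral do rewrite exprMn.
rewrite (meanZ (prob_measT mu) _ (bmeasX 2 bF)) ler_wpM2l ?sqr_ge0//.
exact: (fk_sqr_mean bU C0 UC L0 form t0).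
Qed.

End deviation.

(** * Truncation of the additive functional *)

(** Monotone convergence, in the form used for events: a strict lower bound on the
integral already holds for a truncated integrand. *)
Lemma truncated_integral_gt d (T : measurableType d) (R : realType)
    (mu : {measure set T -> \bar R}) (D : set T) (v : T -> R) (c : R) :
  measurable D -> measurable_fun D v -> (forall x, 0 <= v x) ->
  (c%:E < \int[mu]_(x in D) (v x)%:E)%E ->
  exists k : nat, (c%:E < \int[mu]_(x in D) (Num.min (v x) k%:R)%:E)%E.
Proof.
move=> mD mv v0 cv; apply: contrapT => /forallNP H.
move: cv; rewrite ltNge => /negP; apply.
have -> : (\int[mu]_(x in D) (v x)%:E =
    \int[mu]_(x in D) limn (fun k : nat => (Num.min (v x) k%:R)%:E))%E.
  apply: eq_integral => x _; apply/esym/cvg_lim => //; apply: cvg_near_cst.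
  exists (Num.truncn (v x)).+1 => // k /= hk; congr (_%:E).
  apply/min_idPl; rewrite (le_trans (ltW (truncnS_gt _)))//.
  by rewrite ler_nat.
have m0 (k : nat) x : (0 <= (Num.min (v x) k%:R)%:E)%E by rewrite lee_fin le_min v0/=.
have mm (k : nat) : measurable_fun D (fun x => (Num.min (v x) k%:R)%:E).
  by apply/measurable_EFinP; apply: measurable_minr.
have nd x : {homo (fun k : nat => (Num.min (v x) k%:R)%:E) : i j / (i <= j)%N >-> (i <= j)%E}.
  by move=> i j ij; rewrite lee_fin le_min ge_min lexx/= ge_min ler_nat ij orbT.
rewrite monotone_convergence//; apply: lime_le.
  apply: ereal_nondecreasing_is_cvgn => i j ij; apply: ge0_le_integral => //.
  by move=> x _; exact: nd.
by apply: nearW => k; rewrite leNgt; apply/negP; exact: H.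
Qed.

Section clamp.
Context {R : realType}.
Implicit Types n k v : R.

Definition clamp n k v : R := Num.min (Num.max v (- n)) k.

(** The positive part is cut at k and the negative part at n, independently of each
other. *)
Lemma clampE n k v : 0 <= n -> 0 <= k ->
  clamp n k v = Num.min (Num.max v 0) k - Num.min (Num.max (- v) 0) n.
Proof.
move=> n0 k0; rewrite /clamp; have [v0|v0] := leP 0 v.
  have -> : Num.max (- v) 0 = 0 by apply/max_idPr; rewrite oppr_le0.
  by rewrite (min_idPl n0) subr0; congr Num.min; apply/max_idPl; lra.
have -> : Num.max (- v) 0 = - v by apply/max_idPl; rewrite oppr_ge0 ltW.
rewrite (min_idPl k0) sub0r oppr_min opprK.
by apply/min_idPl; rewrite ge_max; apply/andP; split; lra.
Qed.

Lemma clamp_bound n k v : 0 <= n -> 0 <= k -> `|clamp n k v| <= n + k.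
Proof.
move=> n0 k0; rewrite /clamp ler_norml; apply/andP; split.
  by rewrite le_min le_max; apply/andP; split; [apply/orP; right|]; lra.
by rewrite ge_min; apply/orP; right; lra.
Qed.

Lemma clamp_abs n k v : 0 <= n -> 0 <= k -> `|clamp n k v| <= `|v|.
Proof.
move=> n0 k0; rewrite clampE//.
have [v0|v0] := leP 0 v.
  have -> : Num.max (- v) 0 = 0 by apply/max_idPr; rewrite oppr_le0.
  rewrite (min_idPl n0) subr0 (ger0_norm v0) ger0_norm ?le_min ?v0//.
  by rewrite ge_min lexx.
rewrite (min_idPl k0) sub0r normrN (ltr0_norm v0).
have mv : 0 <= - v by rewrite oppr_ge0 ltW.
by rewrite (max_idPl mv) ger0_norm ?le_min ?mv// ge_min lexx.
Qed.

Lemma clamp_pos_le n k v : 0 <= n -> 0 < clamp n k v -> clamp n k v <= v.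
Proof.
move=> n0; rewrite /clamp lt_min lt_max => /andP[/orP[v0|]]; last by lra.
move=> k0; rewrite ge_min; apply/orP; left.
by rewrite ge_max lexx/=; lra.
Qed.

(** Cutting at - n raises v by at most v^2 / n: this is what keeps the mean of the
truncated potential close to 0. *)
Lemma clamp_le_sqr n k v : 0 < n -> clamp n k v <= v + v ^+ 2 / n.
Proof.
move=> n0; rewrite /clamp ge_min; apply/orP; left; rewrite ge_max; apply/andP; split.
  by rewrite lerDl divr_ge0 ?sqr_ge0// ltW.
rewrite -(ler_pM2r n0) mulrDl divfK ?gt_eqF//.
have := sqr_ge0 (v + n); have := sqr_ge0 n; nra.
Qed.

Lemma clamp_mono n k k' v : k <= k' -> clamp n k v <= clamp n k' v.
Proof. by move=> kk; rewrite /clamp le_min ge_min lexx/= ge_min kk orbT. Qed.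

Lemma measurable_clamp d (T : measurableType d) n k (V : T -> R) :
  measurable_fun setT V -> measurable_fun setT (fun x => clamp n k (V x)).
Proof.
by move=> mV; apply: measurable_minr => //; exact: measurable_maxr.
Qed.

End clamp.

Section time_integral_ereal.
Context {R : realType} {d} {Omega : measurableType d}.
Local Notation leb := (@lebesgue_measure R).

Lemma measurable_itv_integral (h : R -> Omega -> R) a b :
  measurable_fun setT (fun p : measurableTypeR R * Omega => h p.1 p.2) ->
  (forall s w, 0 <= h s w) ->
  measurable_fun setT (fun w => \int[leb]_(s in `[a, b]) (h s w)%:E)%E.
Proof.
move=> mh h0.
have -> : (fun w => \int[leb]_(s in `[a, b]) (h s w)%:E)%E =
    (fun w => \int[leb]_s ((h s w) * \1_(`[a, b]%classic) s)%:E)%E.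
  apply/funext => w; rewrite integral_mkcond; apply: eq_integral => s _.
  by rewrite patchE indicE; case: (s \in _); rewrite ?mulr1 ?mulr0.
apply: (@measurable_fun_fubini_tonelli_G _ _ (measurableTypeR R) Omega R leb
  (fun p => ((h p.1 p.2) * \1_(`[a, b]%classic) p.1)%:E)).
  apply/measurable_EFinP; apply: measurable_funM => //.
  by apply: measurableT_comp => //; exact: measurable_indic.
by move=> [s w] /=; rewrite lee_fin mulr_ge0.
Qed.

End time_integral_ereal.

Section additive_functional.
Context {R : realType} {dE dO : measure_display}.
Context {E : measurableType dE} {Omega : measurableType dO}.
Variables (X : R -> Omega -> E) (Px : R.-pker E ~> Omega).
Hypothesis hX : is_markov_process X Px.
Variables (V : E -> R) (mV : measurable_fun setT V) (t : R) (t0 : 0 < t).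
Local Notation leb := (@lebesgue_measure R).
Local Notation path s w := (V (X (Num.max s 0) w)).
Local Notation clamped lam n k := (fun x => lam * clamp n k (V x)).

Let measurable_pathV : measurable_fun setT
  (fun p : measurableTypeR R * Omega => path p.1 p.2).
Proof. exact: measurableT_comp mV (measurable_positive_path hX). Qed.

Let pos_part (w : Omega) := (\int[leb]_(s in `[0%R, t]) (Num.max (path s w) 0)%:E)%E.
Let neg_part (w : Omega) := (\int[leb]_(s in `[0%R, t]) (Num.max (- path s w) 0)%:E)%E.

Let functionalE w :
  (\int[leb]_(s in `[0%R, t]) (V (X s w))%:E = pos_part w - neg_part w)%E.
Proof.
rewrite integralE; congr (_ - _)%E; apply: eq_integral => s.
  by rewrite inE/= in_itv/= => /andP[s0 _]; rewrite funeposE (max_idPl s0) EFin_max.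
by rewrite inE/= in_itv/= => /andP[s0 _]; rewrite funenegE (max_idPl s0) EFin_max.
Qed.

Let measurable_pos_part : measurable_fun setT pos_part.
Proof.
apply: (@measurable_itv_integral _ _ _ (fun s w => Num.max (path s w) 0)).
  exact: measurable_maxr.
by move=> s w; rewrite le_max lexx orbT.
Qed.

Let measurable_neg_part : measurable_fun setT neg_part.
Proof.
apply: (@measurable_itv_integral _ _ _ (fun s w => Num.max (- path s w) 0)).
  by apply: measurable_maxr => //; exact: measurableT_comp.
by move=> s w; rewrite le_max lexx orbT.
Qed.

Lemma measurable_deviation_event (r : R) : measurable [set w |
  (r%:E <= (t^-1)%:E * \int[leb]_(s in `[0%R, t]) (V (X s w))%:E)%E].
Proof.
under eq_set do rewrite functionalE.
rewrite -[X in measurable X]setTI; apply: emeasurable_fun_c_infty => //.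
by apply: measurable_funeM; exact: emeasurable_funB.
Qed.

Let measurable_path_time w :
  measurable_fun setT (fun s : measurableTypeR R => path s w).
Proof.
exact: (measurableT_comp measurable_pathV (@pair2_measurable _ _ (measurableTypeR R) _ w)).
Qed.

Lemma bmeas_clamped lam n k : 0 <= n -> 0 <= k -> bmeas (clamped lam n k).
Proof.
move=> n0 k0; apply: bmeasM; first exact: bmeas_cst.
split; first exact: measurable_clamp.
by exists (n + k) => x; exact: clamp_bound.
Qed.

(** If the time average of V is at least r, the integral of its negative part is
finite by the meaning of the difference of the two parts, and cutting that
negative part at n only increases the integral. The positive part exceeds a
strictly smaller threshold, so that a cut at some level k suffices. *)
Lemma deviation_event_sub (lam n R' r : R) : 0 < lam -> 0 <= n -> 0 < R' -> R' < r ->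
  [set w | (r%:E <= (t^-1)%:E * \int[leb]_(s in `[0%R, t]) (V (X s w))%:E)%E]
  `<=` \bigcup_(k : nat) [set w | lam * (t * R') <=
     tint (potential X (clamped lam n k%:R)) 0 t w].
Proof.
move=> lam0 n0 R0 Rr w /=; rewrite functionalE.
rewrite (lee_pdivlMl _ _ t0) -EFinM => Hw.
have trp : t * R' < t * r by rewrite ltr_pM2l.
have tRp : 0 < t * R' by rewrite mulr_gt0.
have np0 : (0 <= neg_part w)%E by apply: integral_ge0 => s _; rewrite lee_fin le_max lexx orbT.
(* With an infinite negative part the difference would be -oo, below the threshold. *)
have [gn gnE] : exists gn, neg_part w = gn%:E.
  move: Hw np0; case: (neg_part w) => [a _ _|+ _|//]; first by exists a.
  by rewrite addeNy leeNy_eq.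
have {}Hw : ((gn + t * R')%:E < pos_part w)%E.
  move: Hw; rewrite gnE leeBrDr// -EFinD => /(lt_le_trans _); apply.
  by rewrite lte_fin addrC ltrD2r.
have mD : measurable (`[0, t]%classic : set (measurableTypeR R)) by exact: measurable_itv.
have mp : measurable_fun (`[0, t]%classic : set (measurableTypeR R))
    (fun s : measurableTypeR R => Num.max (path s w) 0).
  by apply: measurable_funTS; apply: measurable_maxr.
have m0 (s : measurableTypeR R) : 0 <= Num.max (path s w) 0 by rewrite le_max lexx orbT.
have [k Hk] := truncated_integral_gt mD mp m0 Hw.
exists k => //=; have k0 : 0 <= k%:R :> R by exact: ler0n.
have mpath := @measurable_path_time w.
pose p (s : measurableTypeR R) := Num.min (Num.max (path s w) 0) k%:R.
pose q (s : measurableTypeR R) := Num.min (Num.max (- path s w) 0) n.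
have p0 s : 0 <= p s by rewrite le_min k0 le_max lexx orbT.
have q0 s : 0 <= q s by rewrite le_min n0 le_max lexx orbT.
have bp : bmeas p.
  split; first by apply: measurable_minr => //; exact: measurable_maxr.
  by exists k%:R => s; rewrite ger0_norm// ge_min lexx orbT.
have bq : bmeas q.
  split; last by exists n => s; rewrite ger0_norm// ge_min lexx orbT.
  by apply: measurable_minr => //; apply: measurable_maxr => //; exact: measurableT_comp.
have lty : ((leb : {measure set (measurableTypeR R) -> \bar R}) `[0%R, t]%classic < +oo)%E.
  by rewrite (lebesgue_itvcc (ltW t0)) ltry.
have ip := bmeas_integrable mD lty bp.
have iq := bmeas_integrable mD lty bq.
have ipq : leb.-integrable `[0, t] (EFin \o (fun s => p s - q s)).
  exact: (bmeas_integrable mD lty (bmeasB bp bq)).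
have -> : tint (potential X (clamped lam n k%:R)) 0 t w =
    lam * (\int[leb]_(s in `[0, t]) p s - \int[leb]_(s in `[0, t]) q s).
  rewrite -(RintegralB mD ip iq) -(RintegralZl lam mD ipq).
  by apply: eq_Rintegral => s _; rewrite /potential clampE.
rewrite ler_pM2l// lerBrDr; apply: ltW.
have hp : gn + t * R' < \int[leb]_(s in `[0, t]) p s.
  by rewrite -lte_fin /Rintegral fineK//; exact: (integrable_fin_num mD ip).
have hq : \int[leb]_(s in `[0, t]) q s <= gn.
  rewrite -lee_fin /Rintegral fineK; last exact: (integrable_fin_num mD iq).
  rewrite -gnE; apply: ge0_le_integral => //.
  - by move=> s _; rewrite lee_fin.
  - by apply/measurable_EFinP; apply: measurable_funTS; exact: bq.1.
  - apply/measurable_EFinP; apply: measurable_funTS; apply: measurable_maxr => //.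
    exact: measurableT_comp.
  - by move=> s _; rewrite lee_fin ge_min lexx.
by rewrite addrC (le_lt_trans _ hp)// lerD2r.
Qed.

Variable nu : probability E R.

(** The events for the truncated functionals increase with k, hence a bound uniform
in k passes to their union. *)
Lemma law_deviation_event_le (lam n R' r : R) (B : \bar R) :
  0 < lam -> 0 <= n -> 0 < R' -> R' < r ->
  (forall k : nat, law_from Px nu [set w | (lam * (t * R') <=
     tint (potential X (clamped lam n k%:R)) 0 t w)%R] <= B)%E ->
  (law_from Px nu [set w |
    r%:E <= (t^-1)%:E * \int[leb]_(s in `[0%R, t]) (V (X s w))%:E] <= B)%E.
Proof.
move=> lam0 n0 R0 Rr H.
pose A (k : nat) := [set w | lam * (t * R') <= tint (potential X (clamped lam n k%:R)) 0 t w].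
have bT k := bmeas_tint (potential_jointly hX (bmeas_clamped lam n0 (ler0n R k))) (ltW t0).
have mA k : measurable (A k).
  have -> : A k = tint (potential X (clamped lam n k%:R)) 0 t @^-1` `[lam * (t * R'), +oo[%classic.
    by apply/seteqP; split=> w /=; rewrite in_itv/= andbT.
  by rewrite -[X in measurable X]setTI; exact: (bT k).1.
have ndA : nondecreasing_seq A.
  move=> i j ij; apply/subsetPset => w /= /le_trans; apply.
  apply: le_Rintegral => //.
  - exact: (itv_integrable w (potential_jointly hX (bmeas_clamped lam n0 (ler0n R i))) (ltW t0)).
  - exact: (itv_integrable w (potential_jointly hX (bmeas_clamped lam n0 (ler0n R j))) (ltW t0)).
  - by move=> s _; rewrite /potential ler_pM2l// clamp_mono// ler_nat.
have mU : measurable (\bigcup_k A k) by exact: bigcupT_measurable.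
apply: (@le_trans _ _ (init_law Px nu (\bigcup_k A k))).
  apply: (le_measure (init_law Px nu)); rewrite ?inE//.
    exact: measurable_deviation_event.
  exact: deviation_event_sub.
apply: (cvge_to_le (nondecreasing_cvg_mu (mu := init_law Px nu) mA mU ndA)).
by apply: nearW => k /=; exact: H.
Qed.

End additive_functional.

(** * The deviation bound at a fixed parameter *)

Section deviation_fixed_parameter.
Context {R : realType} {dE dO : measure_display}.
Context {E : measurableType dE} {Omega : measurableType dO}.
Variables (X : R -> Omega -> E) (Px : R.-pker E ~> Omega).
Hypothesis hX : is_markov_process X Px.
Variable mu : probability E R.
Hypothesis hinv : invariant_measure X Px mu.
Hypothesis hcont : strongly_continuous X Px mu.
Variables (F : R -> \bar R) (hF : is_profile F) (hFS : F_sobolev X Px mu F).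
Variables (CP : R) (hCP : 0 < CP) (hP : poincare X Px mu CP).
Variables (V : E -> R) (mV : measurable_fun setT V) (m : R).
Hypothesis hV2 : (\int[mu]_x (V x ^+ 2)%:E = (m ^+ 2)%:E)%E.
Hypothesis hV0 : (\int[mu]_x (V x)%:E = 0)%E.
Variables (nu : probability E R) (hnu : nu `<< mu).
Variables (t r : R) (t0 : 0 < t) (r0 : 0 < r).
Local Notation N2 := ('N[mu]_2%:E['d (charge_of_finite_measure nu) '/d mu])%E.
Local Notation kappa := (4 * CP)^-1.
Local Notation tilt l := (fun x => 2 * l * V x * \1_[set y | kappa < l * V y] x).

Let iV2 : mu.-integrable setT (EFin \o (fun x => V x ^+ 2)).
Proof.
apply/integrableP; split; first by apply/measurable_EFinP; exact: measurable_funX.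
by under eq_integral do rewrite /= ger0_norm ?sqr_ge0//; rewrite hV2 ltry.
Qed.

Let iV : mu.-integrable setT (EFin \o V).
Proof.
have i1 := bmeas_integrableP (prob_measT mu) (bmeas_cst (T := E) (1 : R)).
apply: (le_integrable measurableT _ _ (integrableD measurableT i1 iV2)).
  exact/measurable_EFinP.
move=> x _ /=; rewrite lee_fin [leRHS]ger0_norm ?addr_ge0 ?sqr_ge0//.
have := sqr_ge0 (`|V x| - 1); rewrite -(real_normK (num_real (V x))); nra.
Qed.

Let tilt_ge0 l x : 0 <= tilt l x.
Proof.
have k0 : 0 < kappa by rewrite invr_gt0 mulr_gt0.
rewrite indicE; have [|_] := boolP (x \in _); last by rewrite mulr0.
rewrite inE /= => h; rewrite mulr1 -mulrA mulr_ge0//.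
exact: ltW (lt_trans k0 h).
Qed.

Let measurable_tilt l : measurable_fun setT (tilt l).
Proof.
apply: measurable_funM.
  by apply: measurable_funM.
apply: measurable_indic; rewrite -[X in measurable X]setTI.
have -> : [set y | kappa < l * V y] = (fun y => l * V y) @^-1` `]kappa, +oo[%classic.
  by apply/seteqP; split=> y /=; rewrite in_itv/= andbT.
by apply: (measurable_funM (measurable_cst l) mV).
Qed.

(** With U = lam V truncated and w the tilted potential at a possibly larger
parameter l: where U > kappa > 0, truncation can only have decreased V,
so l V >= U > kappa and w = 2 l V >= 2 U. The mean of U is at most
lam m^2 / n and that of U^2 at most lam^2 m^2. *)
Lemma form_bound_clamped (lam l n k : R) : 0 < lam -> lam <= l -> 0 < n -> 0 <= k ->
  (Fext F (\int[mu]_x (Finv F (tilt l x))%:E) <= kappa%:E)%E ->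
  forall f g : E -> R, bmeas f -> bmeas g -> is_generator X Px mu f g ->
  \int[mu]_x (g x * f x) + \int[mu]_x (lam * clamp n k (V x) * f x ^+ 2) <=
    (lam * (m ^+ 2 / n) + 8 * CP * (lam ^+ 2 * m ^+ 2)) * \int[mu]_x (f x ^+ 2).
Proof.
move=> lam0 laml n0 k0 Fw f g bf bg fg.
have bU := bmeas_clamped mV lam (ltW n0) k0.
have iU := bmeas_integrableP (prob_measT mu) bU.
have iU2 := bmeas_integrableP (prob_measT mu) (bmeasX 2 bU).
have EV : \int[mu]_x V x = 0 by rewrite /Rintegral hV0.
have EV2 : \int[mu]_x (V x ^+ 2) = m ^+ 2 by rewrite /Rintegral hV2.
apply: (form_bound hX hinv hF hFS hCP hP bU (measurable_tilt l) (tilt_ge0 l) _ Fw) => //.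
- move=> x /= Ux; have kp : 0 < kappa by rewrite invr_gt0 mulr_gt0.
  have cp : 0 < clamp n k (V x) by rewrite -(pmulr_rgt0 _ lam0); exact: lt_trans Ux.
  have cV := clamp_pos_le (ltW n0) cp.
  have lV : lam * clamp n k (V x) <= l * V x by rewrite ler_pM// ltW.
  rewrite indicE mem_set/=; last exact: lt_le_trans lV.
  by rewrite mulr1 -[leRHS]mulrA ler_pM2l.
- have i3 : mu.-integrable setT (EFin \o (fun x => n^-1 * V x ^+ 2)).
    exact: (integrableZl measurableT n^-1 iV2).
  have i4 : mu.-integrable setT (EFin \o (fun x => V x + n^-1 * V x ^+ 2)).
    exact: (integrableD measurableT iV i3).
  have i5 : mu.-integrable setT (EFin \o (fun x => lam * (V x + n^-1 * V x ^+ 2))).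
    exact: (integrableZl measurableT lam i4).
  apply: (@le_trans _ _ (\int[mu]_x (lam * (V x + n^-1 * V x ^+ 2)))).
    apply: (le_Rintegral measurableT iU i5) => x _.
    by rewrite ler_pM2l// [X in _ + X]mulrC clamp_le_sqr.
  rewrite (RintegralZl lam measurableT i4) (RintegralD measurableT iV i3).
  by rewrite (RintegralZl n^-1 measurableT iV2) EV EV2 add0r [n^-1 * _]mulrC.
- have i6 : mu.-integrable setT (EFin \o (fun x => lam ^+ 2 * V x ^+ 2)).
    exact: (integrableZl measurableT (lam ^+ 2) iV2).
  rewrite -EV2 -(RintegralZl (lam ^+ 2) measurableT iV2).
  apply: (le_Rintegral measurableT iU2 i6) => x _.
  rewrite exprMn ler_wpM2l ?sqr_ge0// -(real_normK (num_real (V x))).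
  rewrite -(real_normK (num_real (clamp n k (V x)))).
  by rewrite lerXn2r ?nnegrE// clamp_abs// ltW.
- by rewrite mulr_ge0 ?(ltW lam0)// divr_ge0 ?sqr_ge0// ltW.
- by rewrite mulr_ge0 ?sqr_ge0.
Qed.

(** There is some room dd between y and the exponent at lam. Half of it pays for
lowering the threshold from r to R', the other half for the error
lam m^2 / n of the lower truncation. *)
Lemma deviation_at (lam l y : R) : 0 < lam -> lam <= l ->
  (Fext F (\int[mu]_x (Finv F (tilt l x))%:E) <= kappa%:E)%E ->
  0 < y -> y < r * lam - 8 * m ^+ 2 * CP * lam ^+ 2 ->
  (law_from Px nu [set w | r%:E <= (t^-1)%:E *
      \int[lebesgue_measure]_(s in `[0%R, t]) (V (X s w))%:E]
   <= N2 * (expR (- t * y))%:E)%E.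
Proof.
move=> lam0 laml Fw y0 yq.
pose dd := r * lam - 8 * m ^+ 2 * CP * lam ^+ 2 - y.
have dd0 : 0 < dd by rewrite subr_gt0.
pose R' := r - dd / (2 * lam).
have R'r : R' < r by rewrite ltrBlDr ltrDl divr_gt0// mulr_gt0.
have R'0 : 0 < R'.
  rewrite subr_gt0 ltr_pdivrMr ?mulr_gt0//.
  have : 0 <= 8 * m ^+ 2 * CP * lam ^+ 2.
    by rewrite mulr_ge0 ?sqr_ge0// mulr_ge0 ?(ltW hCP)// mulr_ge0 ?sqr_ge0.
  have : 0 < r * lam by rewrite mulr_gt0.
  rewrite /dd; move: (8 * m ^+ 2 * CP * lam ^+ 2) => z h1 h2; lra.
pose n := 2 * lam * m ^+ 2 / dd + 1.
have n0 : 0 < n.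
  by rewrite ltr_wpDl// divr_ge0 ?(ltW dd0)// mulr_ge0 ?sqr_ge0// mulr_ge0// ltW.
have nb : lam * (m ^+ 2 / n) <= dd / 2.
  rewrite mulrA ler_pdivrMr//.
  have -> : dd / 2 * n = lam * m ^+ 2 + dd / 2 by rewrite /n; field; rewrite gt_eqF.
  by rewrite lerDl ltW// divr_gt0.
apply: (@law_deviation_event_le _ _ _ _ _ _ _ hX _ mV _ t0 nu lam n R' r) => //; first exact: ltW.
move=> k; have k0 : 0 <= k%:R :> R by exact: ler0n.
pose L := lam * (m ^+ 2 / n) + 8 * CP * (lam ^+ 2 * m ^+ 2).
have L0 : 0 <= L.
  apply: addr_ge0; first by rewrite mulr_ge0 ?(ltW lam0)// divr_ge0 ?sqr_ge0// ltW.
  by rewrite mulr_ge0 ?(mulr_ge0 (sqr_ge0 _) (sqr_ge0 _))// mulr_ge0// ltW.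
have C0 : 0 < lam * (n + k%:R) by rewrite mulr_gt0// ltr_pwDl.
have UC x : `|lam * clamp n k%:R (V x)| <= lam * (n + k%:R).
  by rewrite normrM (gtr0_norm lam0) ler_pM2l// clamp_bound// ltW.
have form := @form_bound_clamped lam l n k%:R lam0 laml n0 k0 Fw.
have bU := bmeas_clamped mV lam (ltW n0) k0.
apply: le_trans (chernoff_bounded hX hinv hcont hnu _ bU C0 UC L0 form t0) _.
apply: lee_wpmul2l; first exact: Lnorm_ge0.
rewrite lee_fin ler_expR.
have -> : lam * (t * R') = t * (lam * R') by ring.
rewrite [L * t]mulrC -mulrBr mulNr -mulrN ler_pM2l//.
have -> : lam * R' = lam * r - dd / 2 by rewrite /R'; field; rewrite gt_eqF.
move: nb; rewrite /L /dd; move: (lam * (m ^+ 2 / n)) => z nb.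
have -> : 8 * CP * (lam ^+ 2 * m ^+ 2) = 8 * m ^+ 2 * CP * lam ^+ 2 by ring.
move: nb; move: (8 * m ^+ 2 * CP * lam ^+ 2) => u nb.
have -> : lam * r = r * lam by rewrite mulrC.
by move: (r * lam) nb => v nb; lra.
Qed.

End deviation_fixed_parameter.

(** * The deviation inequality *)

Section optimization.
Context {R : realType}.

(** The right-hand side is continuous in y when N is finite; solving for y turns the
family of bounds into an upper bound for s. *)
Lemma exp_bound_sup (P N : \bar R) (t s : R) : 0 < t ->
  (0 <= P <= 1)%E -> (1 <= N)%E ->
  (forall y, (y < s)%R -> P <= N * (expR (- t * y))%:E)%E ->
  (P <= N * (expR (- t * s))%:E)%E.
Proof.
move=> t0 /andP[P0 P1] N1 H.
case: N N1 H => [n| |] N1 H; last 2 first.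
- by rewrite gt0_mulye ?lte_fin ?expR_gt0// leey.
- by have := lt_le_trans (ltNyr (1 : R)) N1.
case: P P0 P1 H => [p| |] // P0 P1 H.
have n0 : 0 < n by rewrite (lt_le_trans ltr01).
rewrite -EFinM lee_fin; have {H} : forall y, y < s -> p <= n * expR (- t * y).
  by move=> y /H; rewrite -EFinM lee_fin.
have [p0 _|p0 H] := leP p 0; first by rewrite (le_trans p0)// mulr_ge0 ?expR_ge0// ltW.
have pn : 0 < p / n by rewrite divr_gt0.
have aux y : (p <= n * expR (- t * y)) = (y <= - ln (p / n) / t).
  rewrite [n * _]mulrC -ler_pdivrMr// -[X in X <= _](lnK (x := p / n)) ?posrE// ler_expR.
  rewrite ler_pdivlMr//; apply/idP/idP; lra.
rewrite aux leNgt; apply/negP => hs.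
have := H ((- ln (p / n) / t + s) / 2); rewrite aux; move: hs.
move: (- ln (p / n) / t) => z zs; have h : (z + s) / 2 < s by lra.
by move=> /(_ h); lra.
Qed.

(** The exponent exceeds y somewhere on [0, l1], not at 0 since y >= 0; by
continuity it still does slightly to the left, hence strictly below l1. *)
Lemma sup_parabola_slack (r a l1 y : R) : 0 < r -> 0 <= a -> 0 <= y ->
  y < sup [set r * l - a * l ^+ 2 | l in `[0, l1]] ->
  exists l, [/\ 0 < l, l < l1 & y < r * l - a * l ^+ 2].
Proof.
move=> r0 a0 y0 ys.
have l10 : 0 <= l1.
  rewrite leNgt; apply/negP => l1n; move: ys; rewrite set_itv_ge ?image_set0 ?sup0.
    by rewrite ltNge y0.
  by rewrite bnd_simp -ltNge.
have [|_ [l lI <-] yl] := sup_gt _ ys.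
  by exists (r * 0 - a * 0 ^+ 2); exists 0 => //=; rewrite in_itv/= lexx.
move: lI; rewrite /= in_itv/= => /andP[l0 ll1].
have {}l0 : 0 < l.
  rewrite lt_neqAle l0 andbT; apply/eqP => l0'; move: yl.
  by rewrite -l0' expr0n mulr0 mulr0 subrr ltNge y0.
pose q := r * l - a * l ^+ 2.
have qy : 0 < q - y by rewrite subr_gt0.
(* Moving left by eta costs at most r eta, since the quadratic term only helps. *)
pose eta := Num.min (l / 2) ((q - y) / (2 * r)).
have e0 : 0 < eta by rewrite lt_min !divr_gt0// mulr_gt0.
have el : eta <= l / 2 by rewrite ge_min lexx.
have er : r * eta <= (q - y) / 2.
  rewrite -ler_pdivlMl// ge_min; apply/orP; right.
  by rewrite le_eqVlt; apply/orP; left; apply/eqP; field; rewrite gt_eqF.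
exists (l - eta); split; [lra|lra|].
have H : a * (l - eta) ^+ 2 <= a * l ^+ 2.
  apply: ler_wpM2l => //; rewrite lerXn2r ?nnegrE; lra.
apply: (@lt_le_trans _ _ (q - (q - y) / 2)); first lra.
rewrite mulrBr [leRHS]addrAC; apply: lerB => //; exact: lerB.
Qed.

End optimization.
Unset Implicit Arguments.

Theorem theorem2p9 (R : realType) (E : completePseudoMetricType R)
    (hE : polish E)
    (dO : measure_display) (Omega : measurableType dO)
    (X : R -> Omega -> borel E) (Px : R.-pker (borel E) ~> Omega)
    (hX : is_markov_process X Px)
    (mu : probability (borel E) R)
    (hinv : invariant_measure X Px mu) (herg : ergodic X Px mu)
    (hcont : strongly_continuous X Px mu)
    (F : R -> \bar R) (hF : is_profile F) (hFS : F_sobolev X Px mu F)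
    (CP : R) (hCP : 0 < CP) (hP : poincare X Px mu CP)
    (V : borel E -> R) (hVmeas : measurable_fun [set: borel E] V)
    (m : R) (hV2 : (\int[mu]_x (V x ^+ 2)%:E = (m ^+ 2)%:E)%E)
    (hV0 : (\int[mu]_x (V x)%:E = 0)%E)
    (lambda0 : R) (hl0 : 0 < lambda0)
    (hint : (\int[mu]_x (Finv F (lambda0 * Num.max (V x) 0))%:E < +oo)%E)
    (nu : probability (borel E) R) (hnu : nu `<< mu)
    (t : R) (ht : 0 < t) (r : R) (hr : 0 < r) :
  (law_from Px nu
     [set w | r%:E <= (t^-1)%:E *
                \int[lebesgue_measure]_(s in `[0%R, t]) (V (X s w))%:E]
   <= 'N[mu]_2%:E['d (charge_of_finite_measure nu) '/d mu] *
      (expR (- t * sup [set (r * l - 8 * m ^+ 2 * CP * l ^+ 2)%R |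
                         l in `[0%R, lambda1 mu F CP lambda0 V] ]))%:E)%E.
Proof.
have mA := measurable_deviation_event hX hVmeas t r.
have N1 := density_norm_ge1 hnu.
have P1 := init_law_le1 Px nu mA.
have P0 : (0 <= law_from Px nu
     [set w | r%:E <= (t^-1)%:E *
                \int[lebesgue_measure]_(s in `[0%R, t]) (V (X s w))%:E])%E.
  by apply: integral_ge0 => x _; exact: measure_ge0.
apply: exp_bound_sup => //; first by rewrite P0 P1.
(* For y <= 0 the right-hand side is at least 1. *)
move=> y ys; have [y0|y0] := leP y 0.
  apply: (le_trans P1); rewrite -[leLHS]mule1; apply: lee_pmul => //.
  by rewrite lee_fin -expR0 ler_expR mulNr oppr_ge0 pmulr_rle0.
have a0 : 0 <= 8 * m ^+ 2 * CP by rewrite mulr_ge0 ?(ltW hCP)// mulr_ge0 ?sqr_ge0.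
have [l [l0 ll1 yl]] := sup_parabola_slack hr a0 (ltW y0) ys.
(* lambda1 is the supremum of the empty set, hence 0, if no parameter is admissible. *)
have [|l' [_ Fl'] ll'] := sup_gt _ ll1.
  apply/set0P/eqP => S0; move: ll1; rewrite /lambda1 S0 sup0.
  by rewrite ltNge (ltW l0).
exact: (deviation_at hX hinv hcont hF hFS hCP hP hVmeas hV2 hV0 hnu ht hr l0 (ltW ll') Fl' y0 yl).
Qed.
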